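(* Fix a real number $0<\delta<1/2$, a real number $\lambda>0$ and a positive integer $r$. For large $x$, call an integer $n<x^2$ ''$\delta$-normal'' if $|\omega(n)-\log\log x|\le \sqrt{\pi/2}\,(\log\log x)^{\delta}$, where $\omega(n)$ is the number of distinct prime factors of $n$. For integers $b_1,\dots,b_r$ let $\mathcal N_{b_1,\dots,b_r}(x)$ be the number of integers $n\le x$ such that $n+b_i$ is $\delta$-normal for every $1\le i\le r$. Then for any integers $0\le b_1<\cdots<b_r\le \lambda(\log\log x)^{1/2-\delta}$ (which may depend on $x$), $$\frac{1}{x}\mathcal N_{b_1,\dots,b_r}(x)\sim (\log\log x)^{(-1/2+\delta)r}\qquad (x\to\infty).$$
   Context: The asymptotic is as $x\to\infty$, with $\delta,\lambda,r$ fixed; the notion of $\delta$-normal depends on $x$. *)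

(* Defs.v *)
From HB Require Import structures.
From mathcomp Require Import all_boot all_order all_algebra.
From mathcomp Require Import all_classical all_reals all_analysis.
Set Implicit Arguments.
Unset Strict Implicit.
Unset Printing Implicit Defensive.
Import Order.TTheory GRing.Theory Num.Theory.
Import numFieldNormedType.Exports.
Local Open Scope ring_scope.

(* The canonical instance that the asymptotic equivalence ~_ expects at +oo. *)
Canonical pinfty_filter_on (R : numFieldType) :=
  FilterType (pinfty_nbhs R) (@proper_pinfty_nbhs R).

Definition omega (n : nat) : nat := size (primes n).

Definition delta_normal (R : realType) (delta x : R) (n : nat) : bool :=
  (n%:R < x ^+ 2) &&
  (`| (omega n)%:R - ln (ln x) | <= Num.sqrt (pi / 2) * ln (ln x) `^ delta).

(* The variable ranges over the positive integers n <= x. *)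
Definition count_normal (R : realType) (delta : R) (r : nat) (b : 'I_r -> nat)
    (x : R) : nat :=
  \sum_(1 <= n < (Num.truncn x).+1 |
          [forall i, delta_normal delta x (n + b i)]) 1.

(* Main.v *)
Require Import Defs.
From HB Require Import structures.
From mathcomp Require Import all_boot all_order all_algebra.
From mathcomp Require Import all_classical all_reals all_analysis.
From mathcomp Require Import ring lra zify.
Set Implicit Arguments.
Unset Strict Implicit.
Unset Printing Implicit Defensive.
Import Order.TTheory GRing.Theory Num.Theory.
Import numFieldNormedType.Exports.
Local Open Scope classical_set_scope.
Local Open Scope ring_scope.

(* Put L = log log x.  Only the primes of the middle range
   exp(L^2) < p <= exp(e^L / L^2) matter: the number of remaining primes
   dividing n + b_i is at most L^(delta/2), of smaller order than the window
   L^delta, outside a set of n of density O(L^-(r+1)), by a moment bound and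
   Mertens' second theorem.  A middle prime exceeds every b_i, hence divides at
   most one of the n + b_i, and by the Chinese remainder theorem the joint
   factorial moments, of total order O(L), of the numbers of middle primes
   dividing n + b_1, ..., n + b_r are those of r independent Poisson variables
   of parameter M = L + O(log L), up to an error exp(-L^2 + o(L^2)).  This beats
   the e^(O(L)) lost to cancellation when polynomials interpolating the indicator
   of the window at 0, ..., J, with J of order L, turn moments into
   probabilities.  Stirling's formula, whose constant comes from Wallis' integrals,
   evaluates the Poisson probability of a window of half-width
   sqrt(pi/2) L^delta = o(sqrt L) as L^(delta - 1/2). *)

(** The target L^(-r(1/2 - delta)) lies, for large r, below the rate of convergence to the normal
    law, so the joint law of the middle prime counts has to be compared with Poisson laws up to
    errors smaller than powers of L. The two cut-offs answer the two moment errors. Rounding costs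
    at most 1 per tuple of primes, hence (number of primes)^B with B of order L; the upper cut-off
    keeps this at exp(O(e^L / L)), below x e^(-L). Distinctness of the primes in a tuple costs B^2
    M^B / z, where M^B = exp(O(L log L)) is killed by z = exp(L^2). Each cut-off removes only 2 log
    L + O(1) from the sum of reciprocals. The interpolating polynomial is exact only up to J. Beyond
    J its error is at most 4^J C(f, J), whose mean is again a factorial moment, so the same moments
    control the tail. J is about 130 L, because (4M)^J / J! must be exponentially small for M <=
    2L. *)

Definition hits (P : seq nat) (n : nat) : nat := count (fun p => p %| n)%N P.

Lemma hits_rem (P : seq nat) p n : p \in P ->
  hits (rem p P) n = (hits P n - (p %| n))%N.
Proof. by move=> pP; rewrite /hits count_rem pP. Qed.

Lemma sum_const_hits (P : seq nat) n (F : nat) :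
  (\sum_(p <- P | p %| n) F = hits P n * F)%N.
Proof. by rewrite big_const_seq iter_addn_0 mulnC. Qed.

(** A falling factorial counts ordered tuples of distinct entries of [P] dividing [n]: each choice
    of a first entry [p] leaves one hit fewer, those of [rem p P]. *)
Lemma hits_ffactS (P : seq nat) n s :
  ((hits P n) ^_ s.+1 = \sum_(p <- P | p %| n) (hits (rem p P) n) ^_ s)%N.
Proof.
rewrite big_seq_cond (eq_bigr (fun=> ((hits P n).-1 ^_ s)%N)); last first.
  by move=> p /andP[pP pn]; rewrite hits_rem // pn subn1.
by rewrite -big_seq_cond sum_const_hits ffactnS.
Qed.

(** * Joint factorial moments of prime divisor counts *)

Section JointMoments.
Variables (r : nat) (b : 'I_r -> nat).

(** The orders are encoded by a word of labels, the order at [i] being its multiplicity in [cs], so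
    that induction on the word peels off one prime at a time. *)
Definition joint_ffact (P : seq nat) (cs : seq 'I_r) (n : nat) : nat :=
  (\prod_(i < r) (hits P (n + b i)) ^_ (count_mem i cs))%N.

Definition separates (P : seq nat) : Prop :=
  forall p i j, p \in P -> b i = b j %[mod p] -> i = j.

(* A prime of P dividing n + b c divides no other n + b i, so deleting it from P
   only affects the factor of index c. *)
Lemma joint_ffact_cons P c cs n : separates P ->
  joint_ffact P (c :: cs) n =
  (\sum_(p <- P | p %| n + b c) joint_ffact (rem p P) cs n)%N.
Proof.
move=> sepP; rewrite /joint_ffact (bigD1 c) //= eqxx add1n hits_ffactS big_distrl /=.
rewrite big_seq_cond [RHS]big_seq_cond.
apply: eq_bigr => p /andP[pP pn].
rewrite [RHS](bigD1 c) //=; congr (_ * _)%N.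
apply: eq_bigr => i ic; rewrite eq_sym (negbTE ic) add0n hits_rem //.
suff /negbTE-> : ~~ (p %| n + b i)%N by rewrite subn0.
apply: contra ic => pi; apply/eqP/(sepP p) => //.
apply/eqP; rewrite -(eqn_modDl n); apply/eqP.
by move: pi pn; rewrite /dvdn => /eqP-> /eqP->.
Qed.

Variable R : realType.

(** For duplicate-free [P], the sum of 1/(p_1 ... p_m) over ordered m-tuples of distinct entries:
    the main term of a joint factorial moment of total order m. *)
Fixpoint distinct_sum (m : nat) (P : seq nat) : R :=
  if m is m'.+1 then \sum_(p <- P) p%:R^-1 * distinct_sum m' (rem p P) else 1.

Definition recip_sum (P : seq nat) : R := \sum_(p <- P) p%:R^-1.

Lemma count_multiples d a N : (0 < d)%N ->
  (\sum_(1 <= n < N.+1 | d %| n + a) 1 = (N + a) %/ d - a %/ d)%N.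
Proof.
move=> d0; elim: N => [|N IH]; first by rewrite big_geq // subnn.
rewrite big_mkcond big_nat_recr //= -big_mkcond IH addSn divnS //.
have : (a %/ d <= (N + a) %/ d)%N by apply: leq_div2r; rewrite leq_addl.
by case: (d %| _)%N => /=; lia.
Qed.

Lemma count_multiples_approx d a N : (0 < d)%N ->
  `| (\sum_(1 <= n < N.+1 | (d %| n + a)%N) 1)%N%:R - N%:R / d%:R | <= 1 :> R.
Proof.
move=> d0; rewrite count_multiples //.
set q := ((N + a) %/ d - a %/ d)%N.
have h1 : (q * d <= N + d)%N.
  have := leq_divM (N + a) d; have := ltn_ceil a d0; rewrite /q mulnBl; lia.
have h2 : (N <= q * d + d)%N.
  have := leq_divM a d; have := ltn_ceil (N + a) d0; rewrite /q mulnBl; lia.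
have dR : 0 < d%:R :> R by rewrite ltr0n.
move: h1 h2; rewrite -!(ler_nat R) !natrD !natrM => h1 h2.
have -> : q%:R - N%:R / d%:R = (q%:R * d%:R - N%:R) / d%:R :> R.
  by rewrite mulrBl mulfK // gt_eqF.
by rewrite ler_norml ler_pdivlMr // ler_pdivrMr //; apply/andP; split; lra.
Qed.

Lemma dvdn_addr_mod d n a a' : a = a' %[mod d] -> (d %| n + a = (d %| n + a'))%N.
Proof. by move=> e; rewrite /dvdn -modnDmr e modnDmr. Qed.

(** Induction on the word, with an accumulated condition [d %| n + a]: the Chinese remainder theorem
    merges it with [p %| n + b c] into one condition modulo [d * p]. In the end each tuple of primes
    contributes a rounding error of at most 1, and there are at most (size P)^(size cs) tuples. *)
Lemma joint_moment_approx N cs P d a : (0 < d)%N -> uniq P ->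
  (forall p, p \in P -> prime p) -> (forall p, p \in P -> coprime d p) ->
  separates P ->
  `| (\sum_(1 <= n < N.+1 | (d %| n + a)%N) joint_ffact P cs n)%N%:R
     - N%:R / d%:R * distinct_sum (size cs) P |
  <= ((size P) ^ (size cs))%N%:R :> R.
Proof.
elim: cs P d a => [|c cs IH] P d a d0 uP prP copP sepP.
  rewrite /= mulr1 expn0 (eq_bigr (fun=> 1%N)); first exact: count_multiples_approx.
  by move=> n _; rewrite /joint_ffact big1.
have sub p q : q \in rem p P -> q \in P by apply: mem_rem.
have key : (\sum_(1 <= n < N.+1 | d %| n + a) joint_ffact P (c :: cs) n =
  \sum_(p <- P) \sum_(1 <= n < N.+1 | d * p %| n + chinese d p a (b c))
     joint_ffact (rem p P) cs n)%N.
  under eq_bigr do rewrite joint_ffact_cons // big_mkcond.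
  rewrite exchange_big /= !big_seq; apply: eq_bigr => p pP.
  rewrite -big_mkcondr; apply: eq_bigl => n.
  rewrite Gauss_dvd ?copP //; congr (_ && _); apply: dvdn_addr_mod.
    by rewrite chinese_modl ?copP.
  by rewrite chinese_modr ?copP.
rewrite key natr_sum /= mulr_sumr -sumrB expnS natrM.
apply: le_trans (ler_norm_sum _ _ _) _.
have -> : (size P)%:R * (size P ^ size cs)%N%:R
   = \sum_(p <- P) (size P ^ size cs)%N%:R :> R.
  by rewrite big_const_seq iter_addr_0 count_predT mulr_natl.
rewrite big_seq [leRHS]big_seq; apply: ler_sum => p pP.
have p0 : (0 < p)%N by rewrite prime_gt0 ?prP.
have -> : N%:R / d%:R * (p%:R^-1 * distinct_sum (size cs) (rem p P)) =
   N%:R / (d * p)%N%:R * distinct_sum (size cs) (rem p P).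
  by rewrite natrM invfM !mulrA.
apply: le_trans (IH _ _ _ _ _ _ _ _) _.
- by rewrite muln_gt0 d0.
- exact: rem_uniq.
- by move=> q /sub; apply: prP.
- move=> q qP; rewrite coprimeMl copP ?(sub _ _ qP) //= prime_coprime ?prP //.
  rewrite dvdn_prime2 ?prP ?(sub _ _ qP) //.
  by apply/eqP => pq; move: qP; rewrite pq mem_rem_uniq // inE eqxx.
- by move=> q i j /sub; apply: sepP.
- rewrite ler_nat; case: (cs) => // c' s; by rewrite leq_exp2r // size_rem // leq_pred.
Qed.

Lemma recip_sum_rem P p : p \in P -> recip_sum (rem p P) = recip_sum P - p%:R^-1.
Proof.
by move=> pP; rewrite /recip_sum (perm_big _ (perm_to_rem pP)) big_cons /= addrC addrK.
Qed.

Lemma recip_sum_ge0 P : 0 <= recip_sum P.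
Proof. by apply: sumr_ge0 => p _; rewrite invr_ge0. Qed.

Lemma distinct_sum_le m P : distinct_sum m P <= recip_sum P ^+ m.
Proof.
elim: m P => [|m IH] P /=; first by rewrite expr0.
rewrite exprS mulr_suml big_seq [leRHS]big_seq; apply: ler_sum => p pP.
rewrite ler_wpM2l ?invr_ge0 // (le_trans (IH _)) // lerXn2r ?nnegrE ?recip_sum_ge0 //.
by rewrite recip_sum_rem // gerBl invr_ge0.
Qed.

(** Fewer than m primes have been removed when a factor is formed, each of reciprocal at most 1/z,
    so every factor is at least [recip_sum P] - m/z. *)
Lemma distinct_sum_ge m P (z : R) : 0 < z -> (forall p, p \in P -> z <= p%:R) ->
  m%:R / z <= recip_sum P -> (recip_sum P - m%:R / z) ^+ m <= distinct_sum m P.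
Proof.
move=> z0; elim: m P => [|m IH] P zP hM; first by rewrite expr0.
rewrite exprS /=.
apply: (@le_trans _ _ (recip_sum P * (recip_sum P - m.+1%:R / z) ^+ m)).
  apply: ler_wpM2r; first by rewrite exprn_ge0 // subr_ge0.
  by rewrite gerBl divr_ge0 // ltW.
rewrite mulr_suml big_seq [leRHS]big_seq; apply: ler_sum => p pP.
rewrite ler_wpM2l ?invr_ge0 //.
have pz : p%:R^-1 <= z^-1.
  by rewrite lef_pV2 ?posrE ?zP // (lt_le_trans z0 (zP _ pP)).
have le1 : recip_sum P - m.+1%:R / z <= recip_sum (rem p P) - m%:R / z.
  by rewrite recip_sum_rem // -natr1 mulrDl mul1r; lra.
apply: le_trans (IH _ _ _); last 2 first.
- by move=> q /mem_rem; apply: zP.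
- by rewrite -subr_ge0 (le_trans _ le1) // subr_ge0.
- by rewrite lerXn2r // ?nnegrE ?subr_ge0 // -subr_ge0 (le_trans _ le1) // subr_ge0.
Qed.

Lemma bernoulli_sub (M e : R) m : 0 <= e <= M ->
  M ^+ m - (M - e) ^+ m <= m%:R * e * M ^+ m.-1.
Proof.
move=> /andP[e0 eM]; have M0 := le_trans e0 eM.
elim: m => [|m IH]; first by rewrite !expr0 subrr !mul0r.
rewrite !exprS /=.
have h : (M - e) ^+ m <= M ^+ m by rewrite lerXn2r ?nnegrE ?subr_ge0 ?gerBl.
have -> : M * M ^+ m - (M - e) * (M - e) ^+ m =
   M * (M ^+ m - (M - e) ^+ m) + e * (M - e) ^+ m by ring.
have h1 : M * (M ^+ m - (M - e) ^+ m) <= M * (m%:R * e * M ^+ m.-1).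
  by rewrite ler_wpM2l.
have h2 : e * (M - e) ^+ m <= e * M ^+ m by rewrite ler_wpM2l.
rewrite (le_trans (lerD h1 h2)) // -natr1 !mulrDl mul1r lerD2r.
by case: (m) => [|k]; rewrite ?mul0r ?mulr0 // exprS mulrCA mulrA; lra.
Qed.

(** The bound depends on [cs] only through [B], so it applies uniformly to all monomials of an
    expanded product; [1 <= M1] allows the exponent to be raised to [B]. *)
Lemma joint_moment N cs P (z M1 : R) B : (0 < N)%N -> 1 <= M1 -> recip_sum P <= M1 ->
  0 < z -> (size cs <= B)%N -> (0 < size P)%N ->
  (forall p, p \in P -> z <= p%:R) -> B%:R / z <= recip_sum P ->
  uniq P -> (forall p, p \in P -> prime p) -> separates P ->
  `| (\sum_(1 <= n < N.+1) joint_ffact P cs n)%N%:R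
     - N%:R * recip_sum P ^+ size cs |
  <= (size P)%:R ^+ B + N%:R * (B%:R ^+ 2 * M1 ^+ B / z) :> R.
Proof.
move=> N0 M11 PM z0 csB P0 zP hM uP prP sepP.
have := @joint_moment_approx N cs P 1 0 isT uP prP (fun p _ => coprime1n p) sepP.
under eq_bigl do rewrite dvd1n.
rewrite divr1 => h; rewrite -(subrK (N%:R * distinct_sum (size cs) P) (_%:R)) -addrA.
apply: le_trans (ler_normD _ _) _; apply: lerD.
  by apply: le_trans h _; rewrite -natrX ler_nat leq_pexp2l.
rewrite -mulrBr normrM ger0_norm // ler_wpM2l // distrC ger0_norm ?subr_ge0 ?distinct_sum_le //.
have csR : (size cs)%:R <= B%:R :> R by rewrite ler_nat.
have hM' : (size cs)%:R / z <= recip_sum P.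
  by apply: le_trans hM; rewrite ler_wpM2r ?invr_ge0 ?(ltW z0).
apply: le_trans (_ : _ <= recip_sum P ^+ size cs - (recip_sum P - (size cs)%:R / z) ^+ size cs) _.
  by rewrite lerD2l lerN2 distinct_sum_ge.
apply: le_trans (bernoulli_sub _ _) _; first by rewrite divr_ge0 ?(ltW z0).
rewrite mulrA -expr2 mulrAC ler_wpM2r ?invr_ge0 ?(ltW z0) //.
rewrite ler_pM ?exprn_ge0 ?recip_sum_ge0 //; first by rewrite lerXn2r ?nnegrE.
apply: (@le_trans _ _ (M1 ^+ (size cs).-1)).
  by rewrite lerXn2r ?nnegrE ?recip_sum_ge0 // (le_trans ler01).
by rewrite ler_weXn2l //; lia.
Qed.

End JointMoments.

(** * Truncations of the exponential series *)

Section ExpTail.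
Variable R : realType.

Lemma series_exp_coeffE (x : R) n : series (exp_coeff x) n = \sum_(i < n) x ^+ i / i`!%:R.
Proof. by rewrite /series /= big_mkord. Qed.

Lemma exp_partial_sum_le (x : R) n : 0 <= x -> \sum_(i < n) x ^+ i / i`!%:R <= expR x.
Proof.
move=> x0; rewrite -series_exp_coeffE.
apply: (@nondecreasing_cvgn_le _ (series (exp_coeff x))); last exact: is_cvg_series_exp_coeff.
by apply: nondecreasing_series => i _ _; exact: exp_coeff_ge0.
Qed.

Lemma expr_fact_le_expR (x : R) n : 0 <= x -> x ^+ n / n`!%:R <= expR x.
Proof.
move=> x0; apply: le_trans (exp_partial_sum_le n.+1 x0).
rewrite big_ord_recr /= lerDr; apply: sumr_ge0 => i _.
by rewrite divr_ge0 ?exprn_ge0.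
Qed.

(** Since n! i! <= (n+i)!, the tail from index n is at most M^n / n! times a partial sum of the
    series of exp(M); the bound passes to the limit. *)
Lemma exp_tail (M : R) n : 0 <= M ->
  `| \sum_(i < n) (- M) ^+ i / i`!%:R - expR (- M) | <= M ^+ n / n`!%:R * expR M.
Proof.
move=> M0; rewrite distrC.
have h m : `| series (exp_coeff (- M)) (m + n)%N - series (exp_coeff (- M)) n |
    <= M ^+ n / n`!%:R * expR M.
  rewrite !series_exp_coeffE -!(big_mkord xpredT (fun i => (- M) ^+ i / i`!%:R)).
  rewrite (@big_cat_nat _ _ _ n) //=; last exact: leq_addl.
  rewrite addrAC subrr add0r -{1}[n]add0n big_addn addnK.
  apply: le_trans (ler_norm_sum _ _ _) _.
  apply: le_trans (ler_wpM2l _ (exp_partial_sum_le m M0)); last first.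
    by rewrite divr_ge0 ?exprn_ge0.
  rewrite mulr_sumr big_mkord; apply: ler_sum => i _.
  rewrite normrM normrX normrN normfV !ger0_norm // exprD.
  have -> : M ^+ n / n`!%:R * (M ^+ i / i`!%:R) = M ^+ i * M ^+ n / (i`! * n`!)%N%:R.
    by rewrite natrM invfM; ring.
  rewrite ler_wpM2l ?mulr_ge0 ?exprn_ge0 //.
  rewrite lef_pV2 ?posrE ?ltr0n ?muln_gt0 ?fact_gt0 // ler_nat.
  have e := bin_fact (leq_addl i n); rewrite addnK in e.
  by rewrite -e [(n`! * _)%N]mulnC leq_pmull // bin_gt0 leq_addl.
have cv : (fun m => `| series (exp_coeff (- M)) (m + n)%N - series (exp_coeff (- M)) n |)
   @ \oo --> `| expR (- M) - series (exp_coeff (- M)) n |.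
  apply: cvg_norm; apply: cvgB; last exact: cvg_cst.
  by rewrite (cvg_shiftn n); exact: is_cvg_series_exp_coeff.
rewrite -series_exp_coeffE -(cvg_lim _ cv) //; apply: limr_le.
  by apply/cvg_ex; eexists; exact: cv.
by near=> m; exact: h.
Unshelve. all: by end_near. Qed.

End ExpTail.

(** * From factorial moments to window counts *)

Section Window.
Variables (R : realType) (J : nat) (W : pred nat).

Lemma coef_XsubC1_exp j k :
  (('X - 1 : {poly R}) ^+ j)`_k = (-1) ^+ (j + k) * 'C(j, k)%:R.
Proof.
elim: j k => [|j IH] k.
  by rewrite expr0 coef1 bin0n; case: k => [|k]; rewrite ?mulr1 ?mulr0.
rewrite exprS mulrBl mul1r coefB coefXM.
case: k => [|k] /=.
  by rewrite IH sub0r !bin0 !addn0 exprS mulN1r mulNr.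
by rewrite !IH binS natrD addSn addnS !exprS mulrDr; ring.
Qed.

(* Coefficients in the binomial basis of the polynomial of degree at most J
   that interpolates the indicator function of W at 0, ..., J. *)
Definition window_coef (j : nat) : R :=
  \sum_(k < J.+1 | W k) (-1) ^+ (j + k) * 'C(j, k)%:R.

(** Binomial inversion: for fixed k the sum over j is the coefficient of X^k in (1 + (X - 1))^f =
    X^f, which is 1 for k = f and 0 otherwise. *)
Lemma window_coef_interp f : (f <= J)%N ->
  \sum_(j < J.+1) window_coef j * 'C(f, j)%:R = (W f)%:R.
Proof.
move=> fJ.
under eq_bigr do rewrite mulr_suml.
rewrite exchange_big /=.
rewrite (eq_bigr (fun k : 'I_J.+1 => (('X^f : {poly R}))`_k)); last first.
  move=> k _; have -> : 'X^f = (1 + ('X - 1)) ^+ f :> {poly R} by rewrite addrC subrK.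
  rewrite exprDn coef_sum.
  rewrite (big_ord_widen_cond J.+1 xpredT
     (fun i => ((1 ^+ (f - i) * ('X - 1 : {poly R}) ^+ i *+ 'C(f, i))`_k))) //.
  rewrite [RHS]big_mkcond; apply: eq_bigr => j _.
  rewrite expr1n mul1r coefMn coef_XsubC1_exp mulr_natr ltnS /=.
  by case: leqP => // jf; rewrite [X in _ *+ X]bin_small // mulr0n.
under eq_bigr do rewrite coefXn.
rewrite big_mkcond (bigD1 (inord f)) //= inordK ?ltnS // eqxx big1 ?addr0.
  by case: (W f).
move=> i ne; case: ifP => // _; case: eqP => // ef.
by move: ne; rewrite -ef inord_val eqxx.
Qed.

Lemma sum_bin j m : (j < m)%N -> \sum_(k < m) 'C(j, k)%:R = 2 ^+ j :> R.
Proof.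
move=> jm; have -> : 2 = 1 + 1 :> R by [].
rewrite exprDn (big_ord_widen_cond m xpredT (fun i => (1 ^+ (j - i) * 1 ^+ i *+ 'C(j, i)) : R)) //.
rewrite [RHS]big_mkcond; apply: eq_bigr => k _ /=.
rewrite !expr1n mul1r ltnS; case: leqP => // h; by rewrite bin_small.
Qed.

Lemma window_coef_bound j : (j <= J)%N -> `| window_coef j | <= 2 ^+ j.
Proof.
move=> jJ; apply: le_trans (ler_norm_sum _ _ _) _.
rewrite -(@sum_bin j J.+1) // big_mkcond; apply: ler_sum => k _.
case: ifP => // _; by rewrite normrM normrX normrN1 expr1n mul1r ger0_norm.
Qed.

Lemma ffactD f j d : (f ^_ (j + d) = f ^_ j * (f - j) ^_ d)%N.
Proof.
elim: d => [|d IH]; first by rewrite addn0 ffactn0 muln1.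
by rewrite addnS !ffactnSr IH subnDA mulnA.
Qed.

(** In fact C(J, j) C(f, J) = C(f, j) C(f - j, J - j), and the last factor is positive. *)
Lemma bin_le_bin_mul f j : (j <= J <= f)%N -> ('C(f, j) <= 'C(J, j) * 'C(f, J))%N.
Proof.
move=> /andP[jJ Jf].
rewrite -(leq_pmul2r (fact_gt0 J)).
have e : ('C(J, j) * 'C(f, J) * J`! = 'C(J, j) * f ^_ J)%N by rewrite -mulnA bin_ffact.
rewrite e -(leq_pmul2r (fact_gt0 (J - j))) -(leq_pmul2r (fact_gt0 j)).
have -> : ('C(J, j) * f ^_ J * (J - j)`! * j`! = J`! * f ^_ J)%N.
  by rewrite -(bin_fact jJ); lia.
have -> : ('C(f, j) * J`! * (J - j)`! * j`! = J`! * (f ^_ j * (J - j)`!))%N.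
  by rewrite -bin_ffact; lia.
rewrite leq_mul2l; apply/orP; right.
have -> : (f ^_ J = f ^_ j * (f - j) ^_ (J - j))%N by rewrite -ffactD subnKC.
rewrite leq_mul2l -[(_ - _) ^_ _]bin_ffact leq_pmull ?orbT //.
by rewrite bin_gt0 leq_sub2r.
Qed.

(** For f <= J the interpolation is exact. For f > J the coefficient bound 2^j and C(f, j) <= C(J,
    j) C(f, J) give 3^J C(f, J), and 3^J + 1 <= 4^J. The majorant is a multiple of a single binomial
    coefficient, so its mean is a factorial moment. *)
Lemma window_coef_err f : (0 < J)%N ->
  `| \sum_(j < J.+1) window_coef j * 'C(f, j)%:R - (W f)%:R |
  <= 4 ^+ J * 'C(f, J)%:R.
Proof.
move=> J0; case: (leqP f J) => [fJ|Jf].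
  by rewrite window_coef_interp // subrr normr0 mulr_ge0 ?exprn_ge0.
apply: le_trans (ler_normB _ _) _.
have h1 : `|(W f)%:R| <= 'C(f, J)%:R :> R.
  rewrite ger0_norm // (@le_trans _ _ 1%:R) //; first by rewrite ler_nat; case: (W f).
  by rewrite ler_nat bin_gt0 ltnW.
have h2 : `|\sum_(j < J.+1) window_coef j * 'C(f, j)%:R| <= 3 ^+ J * 'C(f, J)%:R.
  apply: le_trans (ler_norm_sum _ _ _) _.
  have -> : 3 = 1 + 2 :> R by ring.
  rewrite exprDn mulr_suml; apply: ler_sum => j _.
  have jJ : (j <= J)%N by rewrite -ltnS.
  rewrite normrM [`|_%:R|]ger0_norm // expr1n mul1r.
  apply: (@le_trans _ _ (2 ^+ j * ('C(J, j) * 'C(f, J))%N%:R)).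
    apply: ler_pM => //; first exact: window_coef_bound.
    by rewrite ler_nat bin_le_bin_mul // jJ ltnW.
  by rewrite natrM mulrA -[X in _ <= X * _]mulr_natr.
apply: le_trans (lerD h2 h1) _.
rewrite -[X in _ + X]mul1r -mulrDl ler_wpM2r //.
case: J J0 => // n _; rewrite !exprS.
have : 1 <= 3 ^+ n :> R by rewrite exprn_ege1 //; lra.
have : 3 ^+ n <= 4 ^+ n :> R by rewrite lerXn2r ?nnegrE //; lra.
by lra.
Qed.

Definition poisson_window (M : R) : R :=
  \sum_(k < J.+1 | W k) expR (- M) * M ^+ k / k`!%:R.

(** If the factorial moments are the powers M^j, the sum over j leaves, for each k in the window,
    M^k / k! times the series of exp(-M) truncated at index J - k. The k-th tail is bounded by
    C(J+1, k) M^(J+1) / (J+1)! e^M, and these binomial coefficients add up to at most 2^(J+1). *)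
Lemma window_coef_poisson (M : R) : 0 <= M ->
  `| \sum_(j < J.+1) window_coef j / j`!%:R * M ^+ j - poisson_window M |
  <= (2 * M) ^+ J.+1 / J.+1`!%:R * expR M.
Proof.
move=> M0.
have -> : \sum_(j < J.+1) window_coef j / j`!%:R * M ^+ j =
  \sum_(k < J.+1 | W k) M ^+ k / k`!%:R *
     \sum_(i < J.+1 - k) (- M) ^+ i / i`!%:R.
  under eq_bigr do rewrite !mulr_suml.
  rewrite exchange_big /=; apply: eq_bigr => k _.
  rewrite -(big_mkord xpredT (fun j => (-1) ^+ (j + k) * 'C(j, k)%:R / j`!%:R * M ^+ j)).
  have kJ : (k <= J.+1)%N by rewrite ltnW.
  rewrite (@big_cat_nat _ _ _ k) //=.
  rewrite big_nat big1 ?add0r; last first.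
    by move=> j /andP[_ jk]; rewrite bin_small // mulr0 !mul0r.
  rewrite -{1}[k : nat]add0n big_addn big_mkord mulr_sumr; apply: eq_bigr => i _.
  have h : ('C(i + k, k)%:R : R) / (i + k)`!%:R = (k`!%:R)^-1 * (i`!%:R)^-1.
    have e := bin_fact (leq_addl i k); rewrite addnK in e.
    rewrite -e natrM natrM !invfM mulVKf //.
    by rewrite pnatr_eq0 -lt0n bin_gt0 leq_addl.
  rewrite -[_ * _%:R / _]mulrA h [(- M) ^+ i]exprNn -addnA addnn exprD.
  by rewrite -muln2 exprM sqrr_sign mulr1 [M ^+ (i + k)]exprD; ring.
rewrite /poisson_window -sumrB.
apply: le_trans (ler_norm_sum _ _ _) _.
have -> : (2 * M) ^+ J.+1 / J.+1`!%:R * expR M =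
   \sum_(k < J.+2) 'C(J.+1, k)%:R * (M ^+ J.+1 / J.+1`!%:R * expR M).
  by rewrite exprMn -(@sum_bin J.+1 J.+2) // !mulr_suml; apply: eq_bigr => k _; ring.
rewrite big_ord_recr /= -[leLHS]addr0; apply: lerD; last first.
  by rewrite !mulr_ge0 ?exprn_ge0 ?invr_ge0 ?expR_ge0.
rewrite big_mkcond; apply: ler_sum => k _; case: ifP => _; last first.
  by rewrite !mulr_ge0 ?exprn_ge0 ?invr_ge0 ?expR_ge0.
have kJ : (k <= J.+1)%N by rewrite ltnW.
rewrite -[X in _ - X]mulrA [expR _ * _]mulrC -mulrBr normrM ger0_norm; last first.
  by rewrite divr_ge0 ?exprn_ge0.
apply: le_trans (ler_wpM2l _ (exp_tail _ M0)) _.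
  by rewrite divr_ge0 ?exprn_ge0.
rewrite le_eqVlt; apply/orP; left; apply/eqP.
have h : ('C(J.+1, k)%:R : R) / J.+1`!%:R = (k`!%:R)^-1 * ((J.+1 - k)`!%:R)^-1.
  have e := bin_fact kJ.
  rewrite -e natrM natrM !invfM mulVKf //.
  by rewrite pnatr_eq0 -lt0n bin_gt0.
rewrite [RHS](_ : _ = ('C(J.+1, k)%:R / J.+1`!%:R) * M ^+ J.+1 * expR M); last by ring.
have eM : M ^+ J.+1 = M ^+ k * M ^+ (J.+1 - k) by rewrite -exprD subnKC.
by rewrite h eM; ring.
Qed.

End Window.

(** * Joint window counts from joint factorial moments *)

Section JointWindow.
Variables (R : realType) (r : nat) (b : 'I_r -> nat) (P : seq nat) (N B J : nat).
Variables (M eta : R).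
Hypothesis BJ : (r * J <= B)%N.
Hypothesis moment : forall cs : seq 'I_r, (size cs <= B)%N ->
  `| (\sum_(1 <= n < N.+1) joint_ffact b P cs n)%N%:R - N%:R * M ^+ size cs | <= eta.

Definition labels (g : 'I_r -> 'I_J.+1) : seq 'I_r :=
  \big[cat/[::]]_(i < r) nseq (g i) i.

Lemma size_labels g : size (labels g) = (\sum_(i < r) g i)%N.
Proof.
rewrite /labels (big_morph size (id1 := 0%N) (op1 := addn)) //; last exact: size_cat.
by apply: eq_bigr => i _; rewrite size_nseq.
Qed.

Lemma count_labels g i : count_mem i (labels g) = g i.
Proof.
rewrite /labels (big_morph (count_mem i) (id1 := 0%N) (op1 := addn)) //; last exact: count_cat.
rewrite (bigD1 i) //= count_nseq /= eqxx mul1n.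
by rewrite big1 ?addn0 // => j /negbTE ji; rewrite count_nseq /= ji.
Qed.

(** The product of r polynomials is expanded over all exponent functions [g]. Each monomial gives a
    joint factorial moment of total order at most r J, and the absolute values of the coefficients
    add up to an r-th power. *)
Lemma sum_prod_coef (c : nat -> R) :
  `| \sum_(1 <= n < N.+1) \prod_(i < r)
       \sum_(j < J.+1) c j * ((hits P (n + b i)) ^_ j)%:R
     - N%:R * (\sum_(j < J.+1) c j * M ^+ j) ^+ r |
  <= (\sum_(j < J.+1) `|c j|) ^+ r * eta.
Proof.
under eq_bigr do rewrite bigA_distr_bigA /=.
rewrite exchange_big /=.
have dist (F : 'I_J.+1 -> R) : (\sum_(j < J.+1) F j) ^+ r =
  \sum_(g : {ffun 'I_r -> 'I_J.+1}) \prod_(i < r) F (g i).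
  have -> : (\sum_(j < J.+1) F j) ^+ r = \prod_(i < r) \sum_(j < J.+1) F j.
    by rewrite prodr_const card_ord.
  exact: (bigA_distr_bigA (fun _ => F)).
rewrite !dist mulr_sumr -sumrB mulr_suml.
apply: le_trans (ler_norm_sum _ _ _) _; apply: ler_sum => g _.
have -> : \sum_(1 <= n < N.+1) \prod_(i < r) (c (g i) * ((hits P (n + b i)) ^_ (g i))%:R) =
   (\prod_(i < r) c (g i)) * (\sum_(1 <= n < N.+1) joint_ffact b P (labels g) n)%N%:R.
  rewrite natr_sum mulr_sumr; apply: eq_bigr => n _.
  rewrite big_split /= /joint_ffact natr_prod; congr (_ * _).
  by apply: eq_bigr => i _; rewrite count_labels.
have -> : \prod_(i < r) (c (g i) * M ^+ g i) = (\prod_(i < r) c (g i)) * M ^+ size (labels g).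
  by rewrite big_split /= size_labels expr_sum.
rewrite mulrCA -mulrBr normrM normr_prod ler_wpM2l ?prodr_ge0 //.
apply: moment; rewrite size_labels; apply: leq_trans BJ.
rewrite -[r in (r * J)%N]card_ord -sum_nat_const; apply: leq_sum => i _.
by rewrite -ltnS.
Qed.

(** Writing the errors as [u i - 1] makes them multiplicative: |t i| <= u i, and t1 t2 - a1 a2 = (t1
    - a1) t2 + a1 (t2 - a2) is at most (u1 - 1) u2 + (u2 - 1) = u1 u2 - 1 in size. *)
Lemma prod_approx (I : finType) (t a u : I -> R) :
  (forall i, `|a i| <= 1) -> (forall i, `|t i - a i| <= u i - 1) ->
  `| \prod_i t i - \prod_i a i | <= \prod_i u i - 1.
Proof.
move=> a1 tau.
suff [] : `| \prod_i t i - \prod_i a i | <= \prod_i u i - 1 /\ `|\prod_i a i| <= 1 by [].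
apply: (big_ind3 (fun t a u : R => `|t - a| <= u - 1 /\ `|a| <= 1)) => //.
- by rewrite !subrr normr0 normr1.
- move=> t1 a1' u1 t2 a2 u2 [h1 k1] [h2 k2]; split; last by rewrite normrM mulr_ile1.
  have -> : t1 * t2 - a1' * a2 = (t1 - a1') * t2 + a1' * (t2 - a2) by ring.
  have t2u : `|t2| <= u2.
    by rewrite -[t2](subrK a2) (le_trans (ler_normD _ _)) //; lra.
  have u10 := le_trans (normr_ge0 _) h1; have u20 := le_trans (normr_ge0 _) h2.
  apply: le_trans (ler_normD _ _) _; rewrite !normrM.
  apply: le_trans (_ : _ <= (u1 - 1) * u2 + 1 * (u2 - 1)) _; last by lra.
  by apply: lerD; apply: ler_pM.
Qed.

(** The product of indicators is replaced by the product of their interpolants. For each n the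
    difference is at most the product of the majorants 1 + 4^J C(f, J), minus 1. The moments
    evaluate both products, hence the factor 2 before the moment error. *)
Lemma joint_window (W : pred nat) : (0 < J)%N -> 0 <= eta -> 0 <= M ->
  `| (\sum_(1 <= n < N.+1 | [forall i : 'I_r, W (hits P (n + b i))]) 1)%N%:R
     - N%:R * (\sum_(j < J.+1) window_coef R J W j / j`!%:R * M ^+ j) ^+ r |
  <= N%:R * ((1 + (4 * M) ^+ J / J`!%:R) ^+ r - 1) + 2 * (1 + expR 4) ^+ r * eta.
Proof.
move=> J0 eta0 M0.
pose c j := window_coef R J W j / j`!%:R.
(* Coefficients, in the falling factorials, of the majorant 1 + 4^J C(f, J). *)
pose u j : R := (j == 0%N)%:R + (j == J)%:R * (4 ^+ J / J`!%:R).
have sumu (F : nat -> R) : \sum_(j < J.+1) u j * F j = F 0%N + 4 ^+ J / J`!%:R * F J.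
  under eq_bigr do rewrite mulrDl.
  rewrite big_split /= (bigD1 ord0) //= mul1r big1 ?addr0; last first.
    by move=> i /negbTE i0; rewrite (_ : (i == 0%N :> nat) = false) ?mul0r.
  congr (_ + _); rewrite big_ord_recr /= eqxx mul1r big1 ?add0r //.
  by move=> i _; rewrite ltn_eqF ?mul0r.
have T n : \sum_(j < J.+1) c j * (n ^_ j)%:R = \sum_(j < J.+1) window_coef R J W j * 'C(n, j)%:R.
  apply: eq_bigr => j _; rewrite /c -bin_ffact natrM -mulrA; congr (_ * _).
  by rewrite mulrC mulfK // pnatr_eq0 -lt0n fact_gt0.
have U n : \sum_(j < J.+1) u j * (n ^_ j)%:R = 1 + 4 ^+ J * 'C(n, J)%:R.
  rewrite (sumu (fun j => (n ^_ j)%:R)) ffactn0; congr (_ + _).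
  rewrite -bin_ffact natrM -mulrA; congr (_ * _).
  by rewrite mulrC mulfK // pnatr_eq0 -lt0n fact_gt0.
(* One constant serves both polynomials: the sum of 2^j / j! is at most e^2 for [c], and 1 + 4^J /
   J! is at most 1 + e^4 for [u]. *)
have Kc : \sum_(j < J.+1) `|c j| <= 1 + expR 4.
  apply: (@le_trans _ _ (\sum_(j < J.+1) 2 ^+ j / j`!%:R)).
    apply: ler_sum => j _; rewrite normrM normfV [`|_%:R|]ger0_norm //.
    by rewrite ler_wpM2r ?invr_ge0 // window_coef_bound // -ltnS.
  apply: le_trans (exp_partial_sum_le _ _) _ => //.
  have : expR 2 <= expR 4 :> R by rewrite ler_expR; lra.
  by move=> ?; lra.
have Ku : \sum_(j < J.+1) `|u j| <= 1 + expR 4.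
  rewrite (eq_bigr (fun j : 'I_J.+1 => u j * 1)); last first.
    move=> j _; rewrite mulr1 ger0_norm // addr_ge0 // mulr_ge0 //.
  rewrite (sumu (fun=> 1)) mulr1 lerD2l; exact: expr_fact_le_expR.
have Ec := sum_prod_coef c; have Eu := sum_prod_coef u.
have Kr (v : nat -> R) : \sum_(j < J.+1) `|v j| <= 1 + expR 4 ->
   (\sum_(j < J.+1) `|v j|) ^+ r * eta <= (1 + expR 4) ^+ r * eta.
  move=> h; rewrite ler_wpM2r // lerXn2r // nnegrE ?sumr_ge0 //.
have {}Ec := le_trans Ec (Kr _ Kc); have {}Eu := le_trans Eu (Kr _ Ku).
rewrite (sumu (fun j => M ^+ j)) expr0 in Eu.
have -> : (4 * M) ^+ J / J`!%:R = 4 ^+ J / J`!%:R * M ^+ J by rewrite exprMn; ring.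
have key : `| (\sum_(1 <= n < N.+1 | [forall i : 'I_r, W (hits P (n + b i))]) 1)%N%:R
   - \sum_(1 <= n < N.+1) \prod_(i < r) \sum_(j < J.+1) c j * ((hits P (n + b i)) ^_ j)%:R |
   <= \sum_(1 <= n < N.+1) \prod_(i < r) \sum_(j < J.+1) u j * ((hits P (n + b i)) ^_ j)%:R
      - N%:R.
  rewrite big_mkcond natr_sum /= distrC -sumrB.
  have -> : N%:R = \sum_(1 <= n < N.+1) 1 :> R.
    by rewrite big_const_nat iter_addr_0 subn1.
  rewrite -sumrB; apply: le_trans (ler_norm_sum _ _ _) _; apply: ler_sum => n _.
  have -> : ((if [forall i : 'I_r, W (hits P (n + b i))] then 1 else 0)%N%:R : R)
     = \prod_(i < r) (W (hits P (n + b i)))%:R.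
    case: ifP => [/forallP h|/negbT]; first by rewrite big1 // => i _; rewrite h.
    by rewrite negb_forall => /existsP[i /negbTE h]; rewrite (bigD1 i) //= h mul0r.
  apply: prod_approx => i; first by case: (W _); rewrite ?normr1 ?normr0.
  by rewrite T U addrAC subrr add0r window_coef_err.
move: Ec Eu key; rewrite -/c.
set S1 := \sum_(1 <= n < N.+1) _; set S2 := \sum_(1 <= n < N.+1) _.
set X := (\sum_(1 <= n < N.+1 | _) 1)%N%:R; set K := (1 + expR 4) ^+ r * eta.
have -> : 2 * (1 + expR 4) ^+ r * eta = 2 * K by rewrite /K; ring.
rewrite mulrBr mulr1 !ler_norml => /andP[a1 a2] /andP[b1 b2] /andP[c1 c2].
by apply/andP; split; lra.
Qed.

End JointWindow.

(** * Mertens' second theorem *)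

Section Mertens.

Lemma prod_primes_dvdn (s : seq nat) n : uniq s -> (forall p, p \in s -> prime p) ->
  (forall p, p \in s -> p %| n)%N -> (\prod_(p <- s) p %| n)%N.
Proof.
elim: s => [|p s IH]; first by rewrite big_nil dvd1n.
move=> /= /andP[ps us] pr dv; rewrite big_cons Gauss_dvd.
  rewrite dv ?mem_head //= IH // => q qs; [apply: pr | apply: dv]; by rewrite inE qs orbT.
rewrite big_seq; apply: (big_ind (fun x => coprime p x)) => [|a c ha hc|q qs].
- exact: coprimen1.
- by rewrite coprimeMr ha.
have prp := pr p (mem_head _ _); have prq : prime q by apply: pr; rewrite inE qs orbT.
rewrite prime_coprime // dvdn_prime2 //; by apply: contraNneq ps => ->.
Qed.

Lemma prime_dvdn_fact p n : prime p -> (p %| n`!)%N = (p <= n)%N.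
Proof.
move=> prp; apply/idP/idP => [|pn]; last by rewrite dvdn_fact // prime_gt0.
elim: n => [|n IH]; first by rewrite fact0 dvdn1 => /eqP p1; rewrite p1 in prp.
rewrite factS Euclid_dvdM // => /orP[/dvdn_leq->//|/IH/leqW//].
Qed.

Lemma fact_leq_exp n : (n`! <= n ^ n)%N.
Proof.
rewrite fact_prod; apply: (@leq_trans (\prod_(1 <= i < n.+1) n)%N).
  rewrite big_nat [leqRHS]big_nat; apply: leq_prod => i /andP[_]; by rewrite ltnS.
by rewrite prod_nat_const_nat subn1.
Qed.

(** Every prime in (m, 2m] divides (2m)! but not m!, hence divides C(2m, m) <= 4^m. *)
Lemma primorial_double m :
  (\prod_(m.+1 <= p < (m + m).+1 | prime p) p <= 4 ^ m)%N.
Proof.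
have le4 : ('C(m + m, m) <= 4 ^ m)%N.
  rewrite -[4%N]/((1 + 1) ^ 2)%N -expnM mul2n -addnn expnDn.
  have hm : (m < (m + m).+1)%N by rewrite ltnS leq_addr.
  by rewrite (bigD1 (Ordinal hm)) //= !exp1n !muln1 leq_addr.
apply: leq_trans le4; rewrite -big_filter; apply: dvdn_leq.
  by rewrite bin_gt0 leq_addr.
apply: prod_primes_dvdn; first by rewrite filter_uniq // iota_uniq.
  by move=> p; rewrite mem_filter => /andP[].
move=> p; rewrite mem_filter mem_index_iota ltnS => /andP[prp /andP[mp pm]].
have p2 : (p %| (m + m)`!)%N by rewrite dvdn_fact // prime_gt0.
have pm' : ~~ (p %| m`!)%N by rewrite prime_dvdn_fact // -ltnNge.
move: p2; rewrite -(bin_fact (leq_addr m m)) addnK !Euclid_dvdM //.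
by rewrite (negbTE pm') !orbF.
Qed.

(** Halving with m = ceil(n/2) gives 16^m 4^m = 4^(3m), and 3m <= 2n for n >= 3; the base 16 absorbs
    the rounding up of n/2. *)
Lemma primorial_le n : (\prod_(1 <= p < n.+1 | prime p) p <= 16 ^ n)%N.
Proof.
elim/ltn_ind: n => n IH.
case: (leqP n 2) => [|n2].
  by case: n IH => [|[|[|]]] // _ _; rewrite /index_iota /= ?big_cons ?big_nil.
pose m := uphalf n.
have nm : (n <= m + m)%N by rewrite /m; lia.
have mn : (m < n)%N by rewrite /m; lia.
have mono : (\prod_(1 <= p < n.+1 | prime p) p <= \prod_(1 <= p < (m + m).+1 | prime p) p)%N.
  rewrite (@big_cat_nat _ _ _ n.+1 1 (m + m).+1) //= leq_pmulr // prodn_cond_gt0 //.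
  by move=> p; exact: prime_gt0.
apply: leq_trans mono _.
rewrite (@big_cat_nat _ _ _ m.+1) //=; last by rewrite ltnS leq_addr.
apply: leq_trans (leq_mul (IH m mn) (primorial_double m)) _.
rewrite -[16%N]/(4 ^ 2)%N -!expnM -expnD leq_exp2l //; rewrite /m; lia.
Qed.

Variable R : realType.

Definition prime_recip (n : nat) : R := \sum_(1 <= p < n.+1 | prime p) p%:R^-1.

Definition prime_log_recip (n : nat) : R := \sum_(1 <= p < n.+1 | prime p) ln p%:R / p%:R.

Definition theta (n : nat) : R := \sum_(1 <= p < n.+1 | prime p) ln p%:R.

Lemma ln_prod (s : seq nat) (F : nat -> R) : (forall p, p \in s -> 0 < F p) ->
  ln (\prod_(p <- s) F p) = \sum_(p <- s) ln (F p).
Proof.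
elim: s => [|p s IH] h; first by rewrite !big_nil ln1.
rewrite !big_cons lnM ?posrE ?h ?mem_head //.
  by rewrite IH // => q qs; rewrite h // inE qs orbT.
rewrite big_seq; apply: prodr_gt0 => q qs; by rewrite h // inE qs orbT.
Qed.

Lemma ln_nat_ge0 n : 0 <= ln n%:R :> R.
Proof. by case: n => [|n]; [rewrite ln0 | rewrite ln_ge0 // ler1n]. Qed.

Lemma theta_le n : theta n <= n%:R * ln 16.
Proof.
rewrite /theta -big_filter -ln_prod; last first.
  by move=> p; rewrite mem_filter => /andP[/prime_gt0 + _]; rewrite ltr0n.
rewrite mulr_natl -lnXn; last by rewrite ltr0n.
have p0 : (0 < \prod_(1 <= p < n.+1 | prime p) p)%N.
  by rewrite prodn_cond_gt0 // => p; exact: prime_gt0.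
rewrite -natr_prod big_filter -natrX ler_ln ?posrE ?ltr0n ?expn_gt0 // ler_nat.
exact: primorial_le.
Qed.

Lemma ln_fact_primes n : ln n`!%:R =
  \sum_(1 <= p < n.+1 | prime p) (logn p n`!)%:R * ln p%:R :> R.
Proof.
have e : perm_eq (primes n`!) [seq p <- index_iota 1 n.+1 | prime p].
  apply: uniq_perm; [exact: primes_uniq | by rewrite filter_uniq // iota_uniq |].
  move=> p; rewrite mem_primes mem_filter mem_index_iota fact_gt0 /= ltnS.
  case prp: (prime p) => //=; rewrite prime_gt0 //=.
  by rewrite prime_dvdn_fact.
rewrite -[RHS]big_filter -(perm_big _ e) /=.
rewrite {1}(prod_prime_decomp (fact_gt0 n)) prime_decompE big_map /= natr_prod ln_prod.
  rewrite big_seq [RHS]big_seq; apply: eq_bigr => p; rewrite mem_primes => /andP[prp _].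
  by rewrite natrX lnXn ?ltr0n ?prime_gt0 // mulr_natl.
by move=> p; rewrite mem_primes => /andP[prp _]; rewrite ltr0n expn_gt0 prime_gt0.
Qed.

Lemma ln_fact_le n : ln n`!%:R <= n%:R * ln n%:R :> R.
Proof.
case: n => [|n]; first by rewrite fact0 ln1 mul0r.
rewrite mulr_natl -lnXn ?ltr0n // ler_ln ?posrE ?exprn_gt0 ?ltr0n ?fact_gt0 //.
by rewrite -natrX ler_nat fact_leq_exp.
Qed.

Lemma ln_fact_ge n : n%:R * ln n%:R - n%:R <= ln n`!%:R :> R.
Proof.
case: n => [|n]; first by rewrite fact0 ln1 mul0r subr0.
have f0 : 0 < (n.+1)`!%:R :> R by rewrite ltr0n fact_gt0.
have n0 : 0 < n.+1%:R :> R by rewrite ltr0n.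
rewrite lerBlDl -lerBlDr mulr_natl -lnXn // -ln_div ?posrE ?exprn_gt0 //.
rewrite -[leRHS]expRK ler_ln ?posrE ?divr_gt0 ?exprn_gt0 ?expR_gt0 //.
exact: expr_fact_le_expR.
Qed.

(** Upper half of Mertens' first theorem: the exponent of p in n! is at least floor(n/p) > n/p - 1,
    so ln n! is at least n times the sum minus [theta n], while ln n! <= n ln n. *)
Lemma prime_log_recip_le n : (0 < n)%N -> prime_log_recip n <= ln n%:R + ln 16.
Proof.
move=> n0; have nR : 0 < n%:R :> R by rewrite ltr0n.
have h : n%:R * prime_log_recip n - theta n <= ln n`!%:R.
  rewrite ln_fact_primes mulr_sumr -sumrB; apply: ler_sum => p prp.
  have p0 : 0 < p%:R :> R by rewrite ltr0n prime_gt0.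
  have -> : n%:R * (ln p%:R / p%:R) - ln p%:R = (n%:R / p%:R - 1) * ln p%:R :> R.
    by rewrite mulrBl mul1r; ring.
  rewrite ler_wpM2r ?ln_nat_ge0 //.
  apply: (@le_trans _ _ (n %/ p)%N%:R); last first.
    rewrite ler_nat logn_fact // big_ltn // expn1 leq_addr //.
  rewrite lerBlDr natr1 ler_pdivrMr // -!natrM ler_nat.
  by rewrite ltnW // ltn_ceil // prime_gt0.
rewrite -(ler_pM2l nR) mulrDr.
by have := theta_le n; have := ln_fact_le n; lra.
Qed.

Lemma sum_log_tail n : \sum_(2 <= m < n.+1) ln m%:R / (m * m.-1)%N%:R <= 2 :> R.
Proof.
case: n => [|n]; first by rewrite big_geq.
(* The majorant telescopes: by ln(x+1) <= ln x + 1/x, the decrease of (ln x + 2)/x from x to x + 1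
   is at least ln(x+1) / (x(x+1)). *)
suff h : \sum_(2 <= m < n.+2) ln m%:R / (m * m.-1)%N%:R <= 2 - (ln n.+1%:R + 2) / n.+1%:R :> R.
  by apply: le_trans h _; rewrite gerBl divr_ge0 // addr_ge0 // ln_nat_ge0.
elim: n => [|n IH]; first by rewrite big_geq // ln1; lra.
rewrite big_nat_recr //= natrM.
set x : R := n.+1%:R; have -> : n.+2%:R = x + 1 by rewrite -natr1.
have x1 : 1 <= x by rewrite ler1n.
have x0 : 0 < x by lra.
have lx : ln (x + 1) <= ln x + x^-1.
  have -> : x + 1 = x * (1 + x^-1) by rewrite mulrDr mulr1 mulfV // gt_eqF.
  have xi : 0 < x^-1 by rewrite invr_gt0.
  by rewrite lnM ?posrE ?addr_gt0 // lerD2l le_ln1Dx // (lt_trans _ xi).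
apply: le_trans (lerD IH (lexx _)) _; rewrite -/x.
rewrite -subr_ge0.
have -> : 2 - (ln (x + 1) + 2) / (x + 1) - (2 - (ln x + 2) / x + ln (x + 1) / ((x + 1) * x))
  = ((ln x + x^-1 - ln (x + 1)) * (x + 1) + (x - 1) / x) / (x * (x + 1)).
  by field; apply/andP; split; lra.
have y0 : 0 <= x - 1 by lra.
have z0 : 0 <= x + 1 by lra.
have l0 : 0 <= ln x + x^-1 - ln (x + 1) by rewrite subr_ge0.
have d0 : 0 <= (x - 1) / x by apply: divr_ge0 => //; apply: ltW.
have e0 : 0 <= x * (x + 1) by apply: mulr_ge0 => //; apply: ltW.
by apply: divr_ge0 => //; apply: addr_ge0 => //; apply: mulr_ge0.
Qed.

(** Legendre's formula, bounded by the geometric series n/(p - 1). The second term, due to the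
    higher powers of p, stays bounded when weighted by ln p, summed over p and divided by n. *)
Lemma logn_fact_le p n : prime p ->
  (logn p n`!)%:R <= n%:R / p%:R + n%:R / (p * p.-1)%N%:R :> R.
Proof.
move=> prp; have p1 := prime_gt1 prp.
have pR : 1 < p%:R :> R by rewrite ltr1n.
have -> : (p * p.-1)%N%:R = p%:R * (p%:R - 1) :> R.
  by rewrite natrM -subn1 natrB // ltnW.
set y : R := p%:R in pR *.
rewrite logn_fact // natr_sum /=.
apply: (@le_trans _ _ (\sum_(1 <= k < n.+1) n%:R * y^-1 ^+ k)).
  apply: ler_sum => k _; rewrite exprVn ler_pdivlMr ?exprn_gt0 //; last by lra.
  by rewrite -natrX -natrM ler_nat leq_divM.
rewrite -mulr_sumr.
have -> : n%:R / y + n%:R / (y * (y - 1)) = n%:R * (y - 1)^-1.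
  by field; apply/andP; split; lra.
rewrite ler_wpM2l //.
suff -> : \sum_(1 <= k < n.+1) y^-1 ^+ k = (1 - y^-1 ^+ n) / (y - 1).
  rewrite ler_pdivrMr ?mulVf; try lra.
  by rewrite gerBl exprn_ge0 // invr_ge0; lra.
elim: (n) => [|k IH]; first by rewrite big_geq // expr0 subrr mul0r.
rewrite big_nat_recr //= IH exprS; field; apply/andP; split; lra.
Qed.

(** The 3 is 1 from ln n! >= n ln n - n plus 2 from the higher prime powers in n!. *)
Lemma prime_log_recip_ge n : (0 < n)%N -> ln n%:R - 3 <= prime_log_recip n.
Proof.
move=> n0; have nR : 0 < n%:R :> R by rewrite ltr0n.
have h : ln n`!%:R <= n%:R * (prime_log_recip n + 2).
  rewrite ln_fact_primes.
  apply: le_trans (_ : _ <= \sum_(1 <= p < n.+1 | prime p)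
     n%:R * (ln p%:R / p%:R + ln p%:R / (p * p.-1)%N%:R)) _.
    apply: ler_sum => p prp.
    apply: le_trans (ler_wpM2r (ln_nat_ge0 p) (logn_fact_le n prp)) _.
    by rewrite le_eqVlt; apply/orP; left; apply/eqP; ring.
  rewrite -mulr_sumr ler_wpM2l // big_split /= lerD2l.
  apply: le_trans (sum_log_tail n).
  rewrite big_ltn_cond //= big_mkcond; apply: ler_sum => p _; case: ifP => // _.
  by rewrite divr_ge0 ?ln_nat_ge0.
rewrite -(ler_pM2l nR).
by have := ln_fact_ge n; lra.
Qed.

(* Partial summation one step at a time: on the left the contributions of n.+1
   to the two sums cancel. *)
Lemma prime_recip_step n : (2 <= n)%N ->
  (prime_recip n.+1 - prime_log_recip n.+1 / ln n.+1%:R)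
  - (prime_recip n - prime_log_recip n / ln n%:R)
  = prime_log_recip n * ((ln n%:R)^-1 - (ln n.+1%:R)^-1) :> R.
Proof.
move=> n2.
have l0 : 0 < ln n.+1%:R :> R by rewrite ln_gt0 // ltr1n ltnS ltnW.
rewrite /prime_recip /prime_log_recip.
rewrite [\sum_(1 <= p < n.+2 | _) _]big_mkcond big_nat_recr //= -big_mkcond.
rewrite [\sum_(1 <= p < n.+2 | _) _]big_mkcond big_nat_recr //= -big_mkcond.
set A := \sum_(1 <= p < n.+1 | _) (ln _ / _); set B := \sum_(_ <= p < _ | _) _.
case: ifP => _; last by ring.
rewrite mulrDl mulrAC mulfV ?gt_eqF // mul1r; ring.
Qed.

(** Put a = ln n and a' = ln(n+1). The increment of [D] is (a' - a)/a' up to K (1/a - 1/a'), and (a'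
    - a)/a' differs from ln a' - ln a by at most 1/a - 1/a', because a' - a <= 1. These errors
    telescope, so [D n] - ln ln n stays bounded, and [D n] differs from the sum of reciprocals by a
    bounded quotient. *)
Theorem mertens_second : exists C : R, forall n, (2 <= n)%N ->
  `| prime_recip n - ln (ln n%:R) | <= C.
Proof.
pose K : R := 3 + ln 16.
have l16 : 0 <= ln 16 :> R by rewrite ln_ge0 //; lra.
have l2 : 0 < ln 2 :> R by rewrite ln_gt0 //; lra.
pose D n : R := prime_recip n - prime_log_recip n / ln n%:R.
have EA n : (0 < n)%N -> `|prime_log_recip n - ln n%:R| <= K.
  move=> n0; have := prime_log_recip_le n0; have := prime_log_recip_ge n0.
  by rewrite ler_norml /K => h1 h2; apply/andP; split; lra.
have inv n : (2 <= n)%N -> `|D n - ln (ln n%:R) - (D 2%N - ln (ln 2))|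
   <= (K + 1) * ((ln 2)^-1 - (ln n%:R)^-1).
  elim: n => // n IH; rewrite ltnS leq_eqVlt => /predU1P[<-|n2].
    by rewrite !subrr normr0 mulr0.
  have st := prime_recip_step n2; rewrite -/(D n.+1) -/(D n) in st.
  have {}IH := IH n2; have {}EA := EA n (ltnW n2).
  have nR : 2 <= n%:R :> R by rewrite ler_nat.
  have a0 : 0 < ln n%:R :> R by rewrite ln_gt0 //; lra.
  have e1 : n.+1%:R = n%:R * (1 + n%:R^-1) :> R.
    by rewrite mulrDr mulr1 mulfV ?natr1 // gt_eqF //; lra.
  have ni : 0 < n%:R^-1 :> R by rewrite invr_gt0; lra.
  have ni1 : n%:R^-1 <= 1 :> R by rewrite invf_le1 //; lra.
  have aa : ln n%:R <= ln n.+1%:R :> R by rewrite ler_ln ?posrE ?ltr0n ?ler_nat // ltnW.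
  have aa1 : ln n.+1%:R <= ln n%:R + 1 :> R.
    rewrite e1 lnM ?posrE; try lra.
    by rewrite lerD2l (le_trans (le_ln1Dx _)) //; lra.
  move: st IH EA; set a := ln n%:R in a0 aa aa1 *; set a' := ln n.+1%:R in aa aa1 *.
  move=> st IH EA.
  have a'0 : 0 < a' by lra.
  have u0 : 0 <= a^-1 - a'^-1 by rewrite subr_ge0 lef_pV2 ?posrE.
  have up : ln a' - ln a <= (a' - a) / a.
    rewrite -ln_div ?posrE //.
    have -> : a' / a = 1 + (a' - a) / a by field; lra.
    apply: le_ln1Dx; rewrite (@lt_le_trans _ _ 0) ?divr_ge0; lra.
  have lo : (a' - a) / a' <= ln a' - ln a.
    rewrite -lerN2 opprB -ln_div ?posrE //.
    have -> : a / a' = 1 + (- ((a' - a) / a')) by field; lra.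
    apply: le_ln1Dx; rewrite ltrN2 ltr_pdivrMr //; lra.
  have dd : (a' - a) / a - (a' - a) / a' <= a^-1 - a'^-1.
    by rewrite -mulrBr ler_piMl //; lra.
  have e2 : prime_log_recip n * (a^-1 - a'^-1) =
     (prime_log_recip n - a) * (a^-1 - a'^-1) + (a' - a) / a'.
    by field; apply/andP; split; lra.
  have e3 : `|(prime_log_recip n - a) * (a^-1 - a'^-1)| <= K * (a^-1 - a'^-1).
    by rewrite normrM (ger0_norm u0) ler_wpM2r.
  have -> : D n.+1 = D n + (D n.+1 - D n) by ring.
  rewrite st e2.
  move: IH e3; rewrite !ler_norml => /andP[i1 i2] /andP[j1 j2].
  set z1 := (a^-1 - a'^-1) in u0 dd j1 j2 *.
  have -> : (K + 1) * ((ln 2)^-1 - a'^-1) = (K + 1) * ((ln 2)^-1 - a^-1) + K * z1 + z1.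
    by rewrite /z1; ring.
  by apply/andP; split; lra.
exists ((K + 1) / ln 2 + `|D 2%N - ln (ln 2)| + 1 + K / ln 2) => n n2.
have K0 : 0 <= K by rewrite /K; lra.
have nR : 2 <= n%:R :> R by rewrite ler_nat.
have ln2n : ln 2 <= ln n%:R :> R by rewrite ler_ln ?posrE; lra.
have ln0 : 0 < ln n%:R :> R by lra.
have h1 := inv n n2.
have h2 : (K + 1) * ((ln 2)^-1 - (ln n%:R)^-1) <= (K + 1) / ln 2.
  by rewrite ler_wpM2l ?gerBl ?invr_ge0; lra.
have h3 : `|prime_log_recip n / ln n%:R| <= 1 + K / ln 2.
  have -> : prime_log_recip n / ln n%:R = 1 + (prime_log_recip n - ln n%:R) / ln n%:R.
    by field; lra.
  apply: le_trans (ler_normD _ _) _; rewrite normr1 lerD2l normrM normfV (gtr0_norm ln0).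
  by rewrite ler_pM ?invr_ge0 ?EA ?lef_pV2 ?posrE // ?(ltnW n2) ?(ltW ln0).
have -> : prime_recip n - ln (ln n%:R) = (D n - ln (ln n%:R) - (D 2%N - ln (ln 2)))
   + (D 2%N - ln (ln 2)) + prime_log_recip n / ln n%:R by rewrite /D; ring.
apply: le_trans (ler_normD _ _) _; apply: le_trans (lerD (ler_normD _ _) (lexx _)) _.
by lra.
Qed.

End Mertens.

(** * Stirling's formula and the local Poisson estimate *)

Section Stirling.
Variable R : realType.
Implicit Types (x t : R).

Lemma is_derive_nondecr (f df : R -> R) a b : a <= b ->
  (forall x, a <= x <= b -> is_derive x 1 f (df x)) ->
  (forall x, a <= x <= b -> 0 <= df x) -> f a <= f b.
Proof.
move=> ab fd df0.
have dx x : x \in `[a, b] -> derivable f x 1.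
  by rewrite in_itv /= => h; case: (fd x h).
apply: (@ger0_derive1_ndecr _ f a b) => //.
- move=> x xab; apply: dx; exact: subset_itv_oo_cc xab.
- move=> x; rewrite in_itv /= => /andP[ax xb].
  have h : a <= x <= b by rewrite !ltW.
  have fdx := fd x h.
  by rewrite derive1E derive_val df0.
- by apply: derivable_within_continuous => x xab; apply: dx.
Qed.

Lemma is_derive_congr (f g : R -> R) x a c :
  is_derive x 1 f a -> f =1 g -> a = c -> is_derive x 1 g c.
Proof. by move=> + /funext <- <-. Qed.

Lemma is_derive_inv_comp (f : R -> R) x a : f x != 0 -> is_derive x 1 f a ->
  is_derive x 1 (fun t => (f t)^-1) (- (a / f x ^+ 2)).
Proof.
move=> fx fd; apply: (is_derive_congr (is_deriveV fx fd)) => //.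
by rewrite /GRing.scale /=; ring.
Qed.

(** At x = 1 + 1/k the bound is exactly 1/(k + 1/2), which is what makes [stirling_seq]
    nonincreasing. *)
Lemma ln_ge_pade x : 1 <= x -> 2 * (x - 1) / (x + 1) <= ln x.
Proof.
move=> x1.
pose f : R -> R := fun t => ln t + 4 * (t + 1)^-1.
pose df : R -> R := fun t => t^-1 - 4 * ((t + 1) ^+ 2)^-1.
suff : f 1 <= f x.
  rewrite /f ln1 add0r => h.
  have -> : 2 * (x - 1) / (x + 1) = 2 - 4 * (x + 1)^-1 by field; lra.
  have e : 4 * (1 + 1)^-1 = 2 :> R by field.
  by rewrite e in h; lra.
apply: (@is_derive_nondecr f df _ _ x1) => t /andP[t1 _].
  have t0 : 0 < t by lra.
  have tn : t + 1 != 0 by lra.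
  have d1 := is_derive1_ln t0.
  have d2 : is_derive t 1 (fun t : R => t + 1) 1.
    by apply: is_derive_eq; rewrite addr0.
  have d3 := @is_derive_inv_comp _ t _ tn d2.
  apply: (is_derive_congr (is_deriveD d1 (is_deriveZ 4 d3))) => //.
  by rewrite /df /GRing.scale /=; ring.
rewrite /df.
have -> : t^-1 - 4 * ((t + 1) ^+ 2)^-1 = (t - 1) ^+ 2 / (t * (t + 1) ^+ 2).
  by field; apply/andP; split; lra.
rewrite divr_ge0 ?sqr_ge0 // mulr_ge0 ?sqr_ge0 //; lra.
Qed.

(** At x = 1 + 1/k, multiplied by k + 1/2, the bound is 1 + (1/k - 1/(k+1))/4: the excess over 1
    telescopes and gives the rate in Stirling's formula. *)
Lemma ln_le_half_sub_inv x : 1 <= x -> ln x <= (x - x^-1) / 2.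
Proof.
move=> x1.
pose f : R -> R := fun t => 2^-1 * t - 2^-1 * t^-1 - ln t.
pose df : R -> R := fun t => 2^-1 * 1 - 2^-1 * (- (t ^+ 2)^-1) - t^-1.
suff : f 1 <= f x.
  by rewrite /f ln1 invr1 subrr subr0 => h; lra.
apply: (@is_derive_nondecr f df _ _ x1) => t /andP[t1 _].
  have t0 : 0 < t by lra.
  have tn : t != 0 by lra.
  have d1 := is_derive1_ln t0.
  have d2 := is_derive_id t (1 : R).
  have d3 := @is_derive_inv_comp _ t _ tn d2.
  apply: (is_derive_congr (is_deriveB (is_deriveB (is_deriveZ 2^-1 d2) (is_deriveZ 2^-1 d3)) d1)) => //.
  by rewrite /df /GRing.scale /=; ring.
rewrite /df.
have -> : 2^-1 * 1 - 2^-1 * (- (t ^+ 2)^-1) - t^-1 = ((t - 1) / t) ^+ 2 / 2.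
  by field; lra.
by rewrite divr_ge0 ?sqr_ge0.
Qed.

(* Antiderivatives of the powers of cosine, vanishing at 0. *)
Fixpoint cos_pow_int (n : nat) : R -> R :=
  match n with
  | 0 => fun t => t
  | 1 => sin
  | n'.+2 => fun t =>
      n'.+2%:R^-1 * (sin t * cos t ^+ n'.+1 + n'.+1%:R * cos_pow_int n' t)
  end.

Lemma is_derive_cosX n t :
  is_derive t 1 (fun t : R => cos t ^+ n) (n%:R * cos t ^+ n.-1 * - sin t).
Proof.
apply: (is_derive_congr (is_deriveX n (is_derive_cos t))) => // x.
by rewrite exprfctE.
Qed.

Lemma is_derive_cos_pow_int n t : is_derive t 1 (cos_pow_int n) (cos t ^+ n).
Proof.
elim/ltn_ind: n t => -[|[|n]] IH t.
- rewrite expr0; exact: is_derive_id.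
- rewrite expr1; exact: is_derive_sin.
have d1 := is_derive_sin t; have d2 := is_derive_cosX n.+1 t.
have d3 := IH n (ltnW (ltnSn _)) t.
have d4 := is_deriveZ n.+2%:R^-1 (is_deriveD (is_deriveM d1 d2) (is_deriveZ n.+1%:R d3)).
apply: (is_derive_congr d4) => //=.
have e : sin t * sin t = 1 - cos t * cos t by rewrite -!expr2 sin2cos2.
have n0 : n.+2%:R != 0 :> R by rewrite pnatr_eq0.
rewrite /GRing.scale /= 2![cos t ^+ _.+1]exprS -[RHS](mulKf n0); congr (_ * _).
rewrite exprS -[n.+2%:R]natr1.
set p := cos t ^+ n; set c := cos t in e *; set s := sin t in e *; set m := n.+1%:R.
have -> : s * (m * p * - s) + c * p * c + m * p = m * p * (1 - s * s) + c * c * p by ring.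
by rewrite e; ring.
Qed.

Definition stirling_seq (k : nat) : R := ln k`!%:R - (k%:R + 2^-1) * ln k%:R + k%:R.

Lemma stirling_seq_step k : (0 < k)%N ->
  0 <= stirling_seq k - stirling_seq k.+1 <= 4^-1 / k%:R - 4^-1 / k.+1%:R.
Proof.
move=> k0; have kR : 1 <= k%:R :> R by rewrite ler1n.
rewrite /stirling_seq factS natrM lnM ?posrE ?ltr0n ?fact_gt0 // -[k.+1%:R]natr1.
move: kR; set x : R := k%:R; clearbody x => x1.
have e : ln (x + 1) = ln x + ln (1 + x^-1).
  rewrite -lnM ?posrE; try lra; first by rewrite mulrDr mulr1 mulfV //; lra.
  by rewrite addr_gt0 // invr_gt0; lra.
have xi : 0 < x^-1 by rewrite invr_gt0; lra.
have h1 : 1 <= 1 + x^-1 by lra.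
have lo := ln_ge_pade h1; have hi := ln_le_half_sub_inv h1.
move: lo hi e; set l := ln (1 + x^-1) => lo hi e.
have -> : ln k`!%:R - (x + 2^-1) * ln x + x -
   (ln (x + 1) + ln k`!%:R - (x + 1 + 2^-1) * ln (x + 1) + (x + 1)) =
   (x + 2^-1) * l - 1 by rewrite e; ring.
apply/andP; split.
  have : (x + 2^-1) * (2 * (1 + x^-1 - 1) / (1 + x^-1 + 1)) <= (x + 2^-1) * l.
    by rewrite ler_wpM2l //; lra.
  have -> : (x + 2^-1) * (2 * (1 + x^-1 - 1) / (1 + x^-1 + 1)) = 1.
    by field; apply/andP; split; lra.
  by lra.
have : (x + 2^-1) * l <= (x + 2^-1) * ((1 + x^-1 - (1 + x^-1)^-1) / 2).
  by rewrite ler_wpM2l //; lra.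
have -> : (x + 2^-1) * ((1 + x^-1 - (1 + x^-1)^-1) / 2) =
   1 + (4^-1 / x - 4^-1 / (x + 1)).
  by field; apply/andP; split; lra.
by lra.
Qed.

(** [stirling_seq k] is nonincreasing and [stirling_seq k] - 1/(4k) nondecreasing. The supremum of
    the latter separates the two sequences, which yields the limit together with its rate. *)
Lemma stirling_seq_limit : exists s : R, forall k, (0 < k)%N ->
  0 <= stirling_seq k - s <= 4^-1 / k%:R.
Proof.
have mono k d : (0 < k)%N ->
    0 <= stirling_seq k - stirling_seq (k + d) <= 4^-1 / k%:R - 4^-1 / (k + d)%:R.
  move=> k0; elim: d => [|d IH]; first by rewrite addn0 !subrr lexx.
  have kd : (0 < k + d)%N by rewrite addn_gt0 k0.
  have := stirling_seq_step kd; rewrite addnS.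
  move: IH; move: (stirling_seq _) (stirling_seq _) (stirling_seq _) => s1 s2 s3.
  move: (4^-1 / k%:R : R) (4^-1 / (k + d)%:R : R) (4^-1 / (k + d).+1%:R : R) => c1 c2 c3.
  by move=> /andP[a1 a2] /andP[b1 b2]; apply/andP; split; lra.
have pos k : 0 <= 4^-1 / k%:R :> R by rewrite divr_ge0.
have cmp j k : (0 < j)%N -> (0 < k)%N ->
    stirling_seq j - 4^-1 / j%:R <= stirling_seq k.
  move=> j0 k0; have pk := pos k; have pj := pos j.
  case: (leqP j k) => jk.
    have := mono j (k - j)%N j0; rewrite subnKC // => /andP[_ h]; lra.
  have := mono k (j - k)%N k0; rewrite subnKC ?(ltnW jk) // => /andP[h _]; lra.
pose E := [set stirling_seq j.+1 - 4^-1 / j.+1%:R | j in [set: nat]].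
exists (sup E) => k k0.
have hs : has_sup E.
  split; first by exists (stirling_seq 1 - 4^-1 / 1); exists 0%N.
  by exists (stirling_seq k) => _ [j _ <-]; apply: cmp.
apply/andP; split.
  rewrite subr_ge0; apply: ge_sup; first by case: hs.
  by move=> _ [j _ <-]; apply: cmp.
rewrite lerBlDr -lerBlDl; apply: ub_le_sup; first by case: hs.
by exists k.-1 => //; rewrite prednK.
Qed.


(** * Wallis' integrals and the constant in Stirling's formula *)

Lemma cos_pow_int0 n : cos_pow_int n 0 = 0.
Proof.
elim/ltn_ind: n => -[|[|n]] IH //=; first by rewrite sin0.
by rewrite sin0 mul0r IH ?mulr0 ?addr0 ?mulr0 // ltnW.
Qed.

(** The integral of cos^n over [0, pi/2], as a value of the antiderivative vanishing at 0. *)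
Definition wallis (n : nat) : R := cos_pow_int n (pi / 2).

Lemma wallisSS n : wallis n.+2 = n.+1%:R / n.+2%:R * wallis n.
Proof. by rewrite /wallis /= cos_pihalf expr0n mulr0 add0r mulrA [_^-1 * _]mulrC. Qed.

Lemma wallis_nincr n : wallis n.+1 <= wallis n.
Proof.
have pi2 : 0 <= pi / 2 :> R by rewrite divr_ge0 // pi_ge0.
rewrite -subr_ge0 /wallis.
rewrite -[leLHS](_ : cos_pow_int n 0 - cos_pow_int n.+1 0 = 0); last first.
  by rewrite !cos_pow_int0 subrr.
pose f t := cos_pow_int n t - cos_pow_int n.+1 t.
apply: (@is_derive_nondecr f (fun t => cos t ^+ n - cos t ^+ n.+1) _ _ pi2) => t /andP[t0 t1].
  exact: is_deriveB (is_derive_cos_pow_int n t) (is_derive_cos_pow_int n.+1 t).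
have c0 : 0 <= cos t by rewrite cos_ge0_pihalf // t1 andbT (le_trans _ t0) // oppr_le0.
have c1 : cos t <= 1 by rewrite cos_le1.
by rewrite subr_ge0 exprS ler_piMl // exprn_ge0.
Qed.

(** The logarithm of 4^n / C(2n, n). *)
Definition ln_central (n : nat) : R :=
  2 * ln n`!%:R + 2 * n%:R * ln 2 - ln (2 * n)`!%:R.

Lemma ln_factS n : ln (n.+1)`!%:R = ln n.+1%:R + ln n`!%:R :> R.
Proof. by rewrite factS natrM lnM ?posrE ?ltr0n ?fact_gt0. Qed.

Lemma ln_centralS n :
  ln_central n.+1 = ln_central n + (ln (2 * n).+2%:R - ln (2 * n).+1%:R).
Proof.
rewrite /ln_central mulnS !add2n !ln_factS.
have -> : (2 * n).+2%:R = 2 * n.+1%:R :> R by rewrite -natrM mulnS.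
rewrite lnM ?posrE ?ltr0n // -[in X in 2 * X * ln 2](natr1 n); ring.
Qed.

Lemma ln_wallis_even n : 0 < wallis (2 * n) /\ ln (wallis (2 * n)) = ln (pi / 2) - ln_central n.
Proof.
have pi2 : 0 < pi / 2 :> R by rewrite divr_gt0 // pi_gt0.
elim: n => [|n [IH0 IH]].
  rewrite /ln_central /wallis muln0 fact0 ln1 /=; split => //; ring.
have h : 0 < (2 * n).+1%:R / (2 * n).+2%:R :> R by rewrite divr_gt0 ?ltr0n.
rewrite mulnS add2n wallisSS; split; first by rewrite mulr_gt0.
rewrite [ln (_ * wallis _)]lnM ?posrE // [ln (_%:R / _)]ln_div ?posrE ?ltr0n // IH ln_centralS; ring.
Qed.

Lemma ln_wallis_odd n :
  0 < wallis (2 * n).+1 /\ ln (wallis (2 * n).+1) = ln_central n - ln (2 * n).+1%:R.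
Proof.
elim: n => [|n [IH0 IH]].
  rewrite /ln_central /wallis muln0 fact0 /= sin_pihalf ln1; split => //; ring.
have h : 0 < (2 * n).+2%:R / (2 * n).+3%:R :> R by rewrite divr_gt0 ?ltr0n.
rewrite mulnS add2n wallisSS; split; first by rewrite mulr_gt0.
rewrite [ln (_ * wallis _)]lnM ?posrE // [ln (_%:R / _)]ln_div ?posrE ?ltr0n // IH ln_centralS; ring.
Qed.

(** With S = [stirling_seq], 2 S(n) - S(2n) tends to s and equals [ln_central n] + (ln 2 - ln n)/2.
    The inequalities W_(2n+2) <= W_(2n+1) <= W_(2n) between Wallis' integrals pin 2 [ln_central n]
    to ln(pi/2) + ln(2n+1) up to O(1/n), so 2s is within 4/n of ln(2 pi) for every n. *)
Lemma stirling : forall k, (0 < k)%N ->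
  0 <= stirling_seq k - ln (2 * pi) / 2 <= 4^-1 / k%:R.
Proof.
have [s hs] := stirling_seq_limit.
suff -> : ln (2 * pi) / 2 = s by [].
have pi0 := pi_gt0 R.
have bound n : (0 < n)%N -> `|2 * s - ln (2 * pi)| <= 4 / n%:R.
  move=> n0; have n20 : (0 < 2 * n)%N by rewrite muln_gt0.
  have /andP[a1 a2] := hs n n0; have /andP[b1 b2] := hs (2 * n)%N n20.
  have [e0 e] := ln_wallis_even n; have [w0 w1] := ln_wallis_odd n.
  have nR : 1 <= n%:R :> R by rewrite ler1n.
  have w : 2 * stirling_seq n - stirling_seq (2 * n) = ln_central n + ln 2 / 2 - ln n%:R / 2.
    by rewrite /stirling_seq /ln_central natrM lnM ?posrE ?ltr0n //; field.
  have h1 : ln_central n - ln (2 * n).+1%:R <= ln (pi / 2) - ln_central n.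
    by rewrite -e -w1 ler_ln ?posrE // wallis_nincr.
  have h2 : ln (pi / 2) - ln_central n.+1 <= ln_central n - ln (2 * n).+1%:R.
    have [e0' e'] := ln_wallis_even n.+1.
    by rewrite -e' -w1 ler_ln ?posrE // mulnS add2n wallis_nincr.
  rewrite ln_centralS in h2.
  have E0 : (2 * n)%:R = 2 * n%:R :> R by rewrite natrM.
  have E1 : (2 * n).+1%:R = 2 * n%:R + 1 :> R by rewrite -natr1 E0.
  have E2 : (2 * n).+2%:R = 2 * n%:R + 1 + 1 :> R by rewrite -natr1 E1.
  have lp1 : ln (pi / 2) = ln pi - ln 2 :> R by rewrite ln_div ?posrE.
  have lp2 : ln (2 * pi) = ln 2 + ln pi :> R by rewrite lnM ?posrE.
  rewrite lp2; rewrite lp1 E1 ?E2 in h1 h2; rewrite E0 in b2.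
  move: h1 h2 b1 b2 w a1 a2.
  move: (stirling_seq n) (stirling_seq (2 * n)) (ln_central n).
  move: nR; move: (n%:R : R) => x x1 S1 S2 q h1 h2 b1 b2 w a1 a2.
  have l1 : ln (2 * x + 1) - ln 2 - ln x <= (2 * x)^-1.
    rewrite -addrA -opprD -lnM ?posrE -?ln_div ?posrE; try lra.
    have -> : (2 * x + 1) / (2 * x) = 1 + (2 * x)^-1 by field; lra.
    have : 0 < (2 * x)^-1 by rewrite invr_gt0; lra.
    by move=> ?; apply: le_ln1Dx; lra.
  have l2 : 0 <= ln (2 * x + 1) - ln 2 - ln x.
    rewrite -addrA -opprD -lnM ?posrE ?subr_ge0 ?ler_ln ?posrE; lra.
  have l3 : ln (2 * x + 1 + 1) - ln (2 * x + 1) <= (2 * x)^-1.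
    rewrite -ln_div ?posrE; try lra.
    have -> : (2 * x + 1 + 1) / (2 * x + 1) = 1 + (2 * x + 1)^-1 by field; lra.
    have i0 : 0 < (2 * x + 1)^-1 by rewrite invr_gt0; lra.
    apply: le_trans (le_ln1Dx _) _; first by lra.
    by rewrite lef_pV2 ?posrE; lra.
  move: a2 b2 l1 l3; rewrite !invfM.
  have : 0 < x^-1 by rewrite invr_gt0; lra.
  move: (x^-1) => y y0 a2 b2 l1 l3.
  by rewrite ler_norml; apply/andP; split; lra.
have : `|2 * s - ln (2 * pi)| <= 0.
  apply/ler_addgt0Pr => e e0; rewrite add0r.
  have n0 : (0 < (Num.truncn (4 / e)).+1)%N by [].
  apply: le_trans (bound _ n0) _.
  rewrite ler_pdivrMr ?ltr0n // -ler_pdivrMl // mulrC.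
  by rewrite ltW // truncnS_gt.
by rewrite normr_le0 subr_eq0 => /eqP h; rewrite -h; field.
Qed.

(** The logarithm of the middle term is k - M + k ln(M/k), minus the Stirling remainder, plus
    ln(L/k)/2. The first part lies between -8A^2/L and 0, since |k - M| <= 2A and M >= L/2; the
    others are at most 1/(2L) and A/L in size. As A >= 1, the total is within 10 A^2/L. *)
Lemma poisson_term (M L A : R) (k : nat) : 1 <= A -> A <= L / 2 ->
  `|k%:R - L| <= A -> `|M - L| <= A ->
  expR (- (10 * A ^+ 2 / L)) <= Num.sqrt (2 * pi * L) * (expR (- M) * M ^+ k / k`!%:R)
    <= expR (10 * A ^+ 2 / L).
Proof.
move=> A1 AL; rewrite !ler_norml => /andP[k1 k2] /andP[M1 M2].
have L2 : 2 <= L by lra.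
have kR : 0 < k%:R :> R by lra.
have k0 : (0 < k)%N by rewrite -(ltr0n R).
have M0 : 0 < M by lra.
have pi0 := pi_gt0 R.
have s0 : 0 < 2 * pi * L by rewrite !mulr_gt0 //; lra.
have f0 : 0 < k`!%:R :> R by rewrite ltr0n fact_gt0.
have p0 : 0 < expR (- M) * M ^+ k / k`!%:R.
  by rewrite divr_gt0 // mulr_gt0 ?expR_gt0 ?exprn_gt0.
have t0 : 0 < Num.sqrt (2 * pi * L) * (expR (- M) * M ^+ k / k`!%:R).
  by rewrite mulr_gt0 // sqrtr_gt0.
rewrite -[X in _ <= X <= _]lnK ?posrE // !ler_expR.
have pp0 : 0 < 2 * pi :> R by lra.
have LL0 : 0 < L by lra.
have ls : ln (Num.sqrt (2 * pi * L)) = ln (2 * pi) / 2 + ln L / 2.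
  have h : ln (2 * pi * L) = ln (Num.sqrt (2 * pi * L)) *+ 2.
    by rewrite -lnXn ?sqrtr_gt0 // sqr_sqrtr // ltW.
  by rewrite lnM ?posrE // mulr2n in h; lra.
have e : ln (Num.sqrt (2 * pi * L) * (expR (- M) * M ^+ k / k`!%:R)) =
  (k%:R - M + k%:R * (ln M - ln k%:R)) - (stirling_seq k - ln (2 * pi) / 2)
   + (ln L - ln k%:R) / 2.
  rewrite [LHS]lnM ?posrE ?sqrtr_gt0 // ls ln_div ?posrE ?mulr_gt0 ?expR_gt0 ?exprn_gt0 //.
  rewrite [ln (expR _ * _)]lnM ?posrE ?expR_gt0 ?exprn_gt0 // expRK lnXn // -mulr_natl /stirling_seq.
  by field.
rewrite e.
have /andP[st1 st2] := stirling k0.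
have ln_up (u v : R) : 0 < u -> 0 < v -> ln u - ln v <= u / v - 1.
  move=> u0 v0; rewrite -ln_div ?posrE //.
  have uv : 0 < u / v by rewrite divr_gt0.
  rewrite -{1}[u / v](subrK 1) addrC; apply: le_ln1Dx; lra.
have q1 : k%:R * (ln M - ln k%:R) <= M - k%:R.
  have := ler_wpM2l (ltW kR) (ln_up _ _ M0 kR).
  have -> : k%:R * (M / k%:R - 1) = M - k%:R by field; lra.
  by [].
have q2 : - ((k%:R - M) ^+ 2 / M) <= k%:R - M + k%:R * (ln M - ln k%:R).
  have := ler_wpM2l (ltW kR) (ln_up _ _ kR M0).
  have -> : - ((k%:R - M) ^+ 2 / M) = k%:R - M - k%:R * (k%:R / M - 1) by field; lra.
  by lra.
have L0 : 0 < L by lra.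
have q3 : (k%:R - M) ^+ 2 / M <= 8 * A ^+ 2 / L.
  rewrite ler_pdivrMr // mulrAC ler_pdivlMr //.
  have h1 : (k%:R - M) ^+ 2 <= 4 * A ^+ 2.
    have : 0 <= (2 * A - (k%:R - M)) * (2 * A + (k%:R - M)) by rewrite mulr_ge0; lra.
    by lra.
  have h2 : 4 * A ^+ 2 * L <= 4 * A ^+ 2 * (2 * M).
    by rewrite ler_wpM2l ?mulr_ge0 ?sqr_ge0 //; lra.
  have h3 : (k%:R - M) ^+ 2 * L <= 4 * A ^+ 2 * L by rewrite ler_wpM2r //; lra.
  by lra.
have ki : k%:R^-1 <= 2 / L.
  by rewrite -[2]invrK -invfM lef_pV2 ?posrE ?mulr_gt0 ?invr_gt0 //; lra.
have r1 : ln L - ln k%:R <= A * (2 / L).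
  apply: le_trans (ln_up _ _ L0 kR) _.
  have -> : L / k%:R - 1 = (L - k%:R) * k%:R^-1 by field; lra.
  have h1 : (L - k%:R) * k%:R^-1 <= A * k%:R^-1 by rewrite ler_wpM2r ?invr_ge0; lra.
  by apply: le_trans h1 _; rewrite ler_wpM2l //; lra.
have r2 : - (A * (2 / L)) <= ln L - ln k%:R.
  rewrite -lerN2 opprK opprB; apply: le_trans (ln_up _ _ kR L0) _.
  have -> : k%:R / L - 1 = (k%:R - L) * L^-1 by field; lra.
  have i0 : 0 <= L^-1 by rewrite invr_ge0; lra.
  have h1 : (k%:R - L) * L^-1 <= A * L^-1 by rewrite ler_wpM2r //; lra.
  apply: le_trans h1 _; rewrite ler_wpM2l //; lra.
have i0 : 0 < L^-1 by rewrite invr_gt0.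
have A2 : A * L^-1 <= A ^+ 2 * L^-1 by rewrite ler_wpM2r ?(ltW i0) // expr2 ler_peMl; lra.
have A3 : L^-1 <= A ^+ 2 * L^-1 by rewrite ler_peMl ?exprn_ege1 ?(ltW i0).
move: st1 st2 q1 q2 q3 r1 r2 ki A2 A3; rewrite -!mulrA.
move: (A ^+ 2 * L^-1) (stirling_seq k) => Q S.
move=> st1 st2 q1 q2 q3 r1 r2 ki A2 A3.
have st3 : 4^-1 * k%:R^-1 <= 4^-1 * (2 / L) by rewrite ler_wpM2l.
by apply/andP; split; lra.
Qed.

End Stirling.

(** * Poisson probability of a window near the mean *)

Section PoissonWindow.
Variable R : realType.

Lemma sum_ltn_minn n m : (\sum_(0 <= k < n | k < m) 1 = minn m n)%N.
Proof.
elim: n => [|n IH]; first by rewrite big_geq // minn0.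
rewrite big_mkcond big_nat_recr //= -big_mkcond IH /minn.
by case: (ltngtP m n) => //; case: (ltngtP m n.+1) => //; lia.
Qed.

Definition real_window (lo hi : R) : pred nat := fun k => lo <= k%:R <= hi.

Lemma count_real_window (lo hi : R) J : 0 <= lo -> lo <= hi -> hi <= J%:R ->
  hi - lo - 2 <= (\sum_(k < J.+1 | real_window lo hi k) 1)%N%:R <= hi - lo + 2.
Proof.
move=> lo0 lohi hiJ; have hi0 := le_trans lo0 lohi.
set c := (\sum_(k < _ | _) _)%N.
set a := Num.truncn lo; set e := Num.truncn hi.
have /andP[a1 a2] : a%:R <= lo < a.+1%:R by rewrite truncn_itv.
have /andP[e1 e2] : e%:R <= hi < e.+1%:R by rewrite truncn_itv.
have eJ : (e <= J)%N.
  by rewrite -ltnS -(ltr_nat R) (le_lt_trans e1) // (le_lt_trans hiJ) // ltr_nat.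
(* The integers below [lo] and those of the window together are 0, ..., floor(hi). *)
have split_sum : (\sum_(0 <= k < J.+1 | ((k%:R : R) < lo)%R) 1 + c = e.+1)%N.
  rewrite -[e.+1](minn_idPl (_ : e.+1 <= J.+1)%N) // -sum_ltn_minn.
  rewrite /c -(big_mkord (real_window lo hi) (fun=> 1%N)).
  rewrite big_mkcond [X in (_ + X)%N]big_mkcond [RHS]big_mkcond -big_split /=.
  apply: eq_bigr => k _; rewrite /real_window.
  have -> : (k < e.+1)%N = (k%:R <= hi).
    apply/idP/idP => [ke|kh]; first by rewrite (le_trans _ e1) // ler_nat.
    by rewrite -(ltr_nat R) (le_lt_trans kh).
  case: ltP => [kl|lk] /=; first by rewrite (le_trans (ltW kl) lohi).
  by case: ifP.
have lb : (a <= \sum_(0 <= k < J.+1 | ((k%:R : R) < lo)%R) 1)%N.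
  have aJ : (a <= J.+1)%N.
    rewrite -(ler_nat R) (le_trans a1) // (le_trans lohi) // (le_trans hiJ) // ler_nat //.
  rewrite -[leqLHS](minn_idPl aJ) -sum_ltn_minn big_mkcond [leqRHS]big_mkcond.
  apply: leq_sum => k _; case: ifP => // ka.
  by rewrite (lt_le_trans _ a1) // ltr_nat.
have ub : (\sum_(0 <= k < J.+1 | ((k%:R : R) < lo)%R) 1 <= a.+1)%N.
  apply: leq_trans (geq_minl a.+1 J.+1).
  rewrite -sum_ltn_minn big_mkcond [leqRHS]big_mkcond.
  apply: leq_sum => k _; case: ifP => // ka.
  by have -> : (k < a.+1)%N by rewrite -(ltr_nat R) (lt_trans ka).
have c1 : (c <= e.+1 - a)%N by lia.
have c2 : (e.+1 - a.+1 <= c)%N by lia.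
have ae : (a <= e)%N by rewrite -ltnS -(ltr_nat R) (le_lt_trans a1) // (le_lt_trans lohi).
move: c1 c2; rewrite -!(ler_nat R) !natrB // ?(leqW ae) //.
move: a2 e2; rewrite -!natr1 => a2 e2 c1 c2.
by apply/andP; split; lra.
Qed.

Lemma poisson_real_window (M L A lo hi : R) (J : nat) :
  1 <= A -> A <= L / 2 -> `|M - L| <= A ->
  L - A <= lo -> lo <= hi -> hi <= L + A -> hi <= J%:R ->
  (hi - lo - 2) * expR (- (10 * A ^+ 2 / L))
    <= Num.sqrt (2 * pi * L) * poisson_window J (real_window lo hi) M
    <= (hi - lo + 2) * expR (10 * A ^+ 2 / L).
Proof.
move=> A1 AL ML loA lohi hiA hiJ.
have lo0 : 0 <= lo by lra.
have /andP[c1 c2] := count_real_window lo0 lohi hiJ.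
have term k : real_window lo hi k -> expR (- (10 * A ^+ 2 / L)) <=
    Num.sqrt (2 * pi * L) * (expR (- M) * M ^+ k / k`!%:R) <= expR (10 * A ^+ 2 / L).
  move=> /andP[k1 k2]; apply: poisson_term => //.
  by rewrite ler_norml; apply/andP; split; lra.
have cst (c : R) : (\sum_(k < J.+1 | real_window lo hi k) 1)%N%:R * c =
    \sum_(k < J.+1 | real_window lo hi k) c.
  by rewrite natr_sum mulr_suml; apply: eq_bigr => k _; rewrite mul1r.
rewrite /poisson_window mulr_sumr; apply/andP; split.
  apply: le_trans (ler_wpM2r (expR_ge0 _) c1) _.
  by rewrite cst; apply: ler_sum => k /term /andP[].
apply: le_trans _ (ler_wpM2r (expR_ge0 _) c2).
by rewrite cst; apply: ler_sum => k /term /andP[].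
Qed.

End PoissonWindow.

(** * Exceptional primes *)

Section ExceptionalPrimes.
Variable R : realType.

(** The recursion on tuples is that of the joint moments, but bounding the number of multiples by (N
    + b)/d from above leaves no rounding error. This matters for the exceptional primes, which go up
    to 2N: an error of size (size Q)^s would swamp N. *)
Lemma hits_moment_le N b s (Q : seq nat) d : (0 < d)%N -> uniq Q ->
  (forall p, p \in Q -> prime p) -> (forall p, p \in Q -> coprime d p) ->
  (\sum_(1 <= n < N.+1 | (d %| n + b)%N) (hits Q (n + b)) ^_ s)%N%:R
  <= (N + b)%:R / d%:R * recip_sum R Q ^+ s.
Proof.
elim: s Q d => [|s IH] Q d d0 uQ prQ copQ.
  rewrite expr0 mulr1 (eq_bigr (fun=> 1%N)) // count_multiples //.
  rewrite ler_pdivlMr ?ltr0n // -natrM ler_nat mulnBl.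
  by apply: leq_trans (leq_subr _ _) (leq_divM _ _).
have -> : (\sum_(1 <= n < N.+1 | d %| n + b) (hits Q (n + b)) ^_ s.+1 =
  \sum_(p <- Q) \sum_(1 <= n < N.+1 | d * p %| n + b) (hits (rem p Q) (n + b)) ^_ s)%N.
  under eq_bigr do rewrite hits_ffactS // big_mkcond.
  rewrite exchange_big /= !big_seq; apply: eq_bigr => p pQ.
  rewrite -big_mkcondr; apply: eq_bigl => n.
  by rewrite Gauss_dvd ?copQ.
rewrite natr_sum /= exprS {1}/recip_sum mulr_suml mulr_sumr.
rewrite big_seq [leRHS]big_seq; apply: ler_sum => p pQ.
have p0 : (0 < p)%N by rewrite prime_gt0 ?prQ.
apply: le_trans (IH _ _ _ _ _ _) _.
- by rewrite muln_gt0 d0.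
- exact: rem_uniq.
- by move=> q /mem_rem; apply: prQ.
- move=> q qQ; rewrite coprimeMl copQ ?(mem_rem qQ) //= prime_coprime ?prQ //.
  rewrite dvdn_prime2 ?prQ ?(mem_rem qQ) //.
  by apply/eqP => pq; move: qQ; rewrite pq mem_rem_uniq // inE eqxx.
rewrite natrM invfM !mulrA ler_wpM2l ?mulr_ge0 ?invr_ge0 //.
rewrite lerXn2r ?nnegrE ?recip_sum_ge0 //.
by rewrite recip_sum_rem // gerBl invr_ge0.
Qed.

Lemma ffact_ge_exp K s : ((K - s) ^ s <= K ^_ s)%N.
Proof.
elim: s => [|s IH]; first by rewrite ffactn0.
rewrite ffactnSr expnSr; apply: leq_mul; last by lia.
by apply: leq_trans IH; case: s => // s; rewrite leq_exp2r //; lia.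
Qed.

Lemma leq_ffact K m s : (K <= m)%N -> (K ^_ s <= m ^_ s)%N.
Proof.
elim: s K m => [|s IH] K m Km; first by rewrite !ffactn0.
by rewrite !ffactnS leq_mul // IH //; lia.
Qed.

(** Markov's inequality for the s-th factorial moment: from K hits on, the falling factorial is at
    least (K - s)^s >= (h - s)^s. *)
Lemma count_many_hits N b s K (Q : seq nat) (h : R) : s%:R < h -> h <= K%:R -> uniq Q ->
  (forall p, p \in Q -> prime p) ->
  (\sum_(1 <= n < N.+1 | (K <= hits Q (n + b))%N) 1)%N%:R
  <= (N + b)%:R * (recip_sum R Q / (h - s%:R)) ^+ s.
Proof.
move=> sh hK uQ prQ.
have hs : 0 < h - s%:R by rewrite subr_gt0.
rewrite expr_div_n mulrA ler_pdivlMr ?exprn_gt0 //.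
have := hits_moment_le N b s (d := 1) isT uQ prQ (fun p _ => coprime1n p).
rewrite divr1; apply: le_trans.
under [X in _ <= X%:R]eq_bigl do rewrite dvd1n.
have sK : (s <= K)%N by rewrite -(ler_nat R) (le_trans (ltW sh)).
apply: (@le_trans _ _ (\sum_(1 <= n < N.+1 | (K <= hits Q (n + b))%N) (K - s) ^ s)%N%:R).
  rewrite natr_sum [leRHS]natr_sum mulr_suml; apply: ler_sum => n _.
  by rewrite mul1r natrX natrB // lerXn2r ?nnegrE ?subr_ge0 ?lerD2r ?ler_nat // ltW.
rewrite ler_nat big_mkcond; apply: leq_sum => n _; case: ifP => // hn.
apply: leq_trans (ffact_ge_exp _ _) _.
exact: leq_ffact.
Qed.

Lemma omega_split T m (C : pred nat) : (0 < m <= T)%N ->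
  omega m = (hits [seq p <- index_iota 1 T.+1 | prime p && C p] m +
             hits [seq p <- index_iota 1 T.+1 | prime p && ~~ C p] m)%N.
Proof.
move=> /andP[m0 mT]; rewrite /omega.
have e : perm_eq (primes m) [seq p <- index_iota 1 T.+1 | prime p && (p %| m)%N].
  apply: uniq_perm; [exact: primes_uniq | by rewrite filter_uniq // iota_uniq |].
  move=> p; rewrite mem_primes mem_filter mem_index_iota m0 /= ltnS.
  case prp: (prime p) => //=; case pm: (p %| m)%N => //=.
  by rewrite prime_gt0 //= (leq_trans (dvdn_leq m0 pm)).
rewrite (perm_size e) /hits !count_filter size_filter.
rewrite -(count_predUI _ _ (index_iota 1 T.+1)).
rewrite [X in _ = (_ + X)%N](eq_count (a2 := pred0)) ?count_pred0 ?addn0.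
  by apply: eq_count => p /=; case: (prime p); case: (p %| m)%N; case: (C p).
by move=> p /=; case: (prime p); case: (p %| m)%N; case: (C p).
Qed.

Lemma recip_sum_prime (z y T : nat) : (z <= y <= T)%N ->
  recip_sum R [seq p <- index_iota 1 T.+1 | prime p && (z < p <= y)%N] =
    prime_recip R y - prime_recip R z /\
  recip_sum R [seq p <- index_iota 1 T.+1 | prime p && ~~ (z < p <= y)%N] =
    prime_recip R T - (prime_recip R y - prime_recip R z).
Proof.
move=> /andP[zy yT].
have e1 : recip_sum R [seq p <- index_iota 1 T.+1 | prime p && (z < p <= y)%N] =
    prime_recip R y - prime_recip R z.
  rewrite /recip_sum big_filter /prime_recip.
  rewrite (@big_cat_nat _ _ _ z.+1 1 y.+1) //= addrAC subrr add0r.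
  rewrite (@big_cat_nat _ _ _ z.+1 1 T.+1) //=; last by lia.
  rewrite big_nat_cond big1 ?add0r; last by move=> p; lia.
  rewrite (@big_cat_nat _ _ _ y.+1 z.+1 T.+1) //=.
  rewrite [X in _ + X]big_nat_cond [X in _ + X]big1 ?addr0; last by move=> p; lia.
  rewrite big_nat_cond [RHS]big_nat_cond; apply: eq_bigl => p.
  by case: (prime p); lia.
split=> //; rewrite -e1 /recip_sum !big_filter /prime_recip.
by rewrite [\sum_(1 <= p < T.+1 | prime p) _](bigID (fun p => (z < p <= y)%N)) /= addrAC subrr add0r.
Qed.

End ExceptionalPrimes.

(** * From omega to the counts of middle primes *)

Section Comparison.
Variable R : realType.

Lemma count_le_add (I : finType) N (X Y : pred nat) (Z : I -> pred nat) :
  (forall n, (1 <= n <= N)%N -> X n -> (forall i, ~~ Z i n) -> Y n) ->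
  (\sum_(1 <= n < N.+1 | X n) 1 <=
   \sum_(1 <= n < N.+1 | Y n) 1 + \sum_i \sum_(1 <= n < N.+1 | Z i n) 1)%N.
Proof.
move=> XYZ.
under [X in (_ <= _ + X)%N]eq_bigr do rewrite big_mkcond.
rewrite exchange_big /= big_mkcond [X in (_ <= X + _)%N]big_mkcond -big_split /=.
rewrite big_nat [leqRHS]big_nat; apply: leq_sum => n nN; case: ifP => // Xn.
have nN' : (1 <= n <= N)%N by [].
case: ifP => // /negbT Yn; rewrite add0n.
have [i Zin] : exists i, Z i n.
  apply/existsP; apply: contraNT Yn; rewrite negb_exists => /forallP h.
  exact: XYZ.
by rewrite (bigD1 i) //= Zin.
Qed.

(** Since n + b_i <= 2N, omega is the sum of the hits of [P] and of [Q], the latter between 0 and h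
    off the exceptional n. As [Q] can only add, the window for [P] moves on one side: extended at
    the bottom for the upper bound, cut at the top for the lower one. *)
Lemma count_normal_sandwich (delta x h : R) r (b : 'I_r -> nat) (C : pred nat) :
  2 < x -> 0 <= h -> (forall i, (b i <= Num.truncn x)%N) ->
  let N := Num.truncn x in
  let L := ln (ln x) in
  let w := Num.sqrt (pi / 2) * L `^ delta in
  let P := [seq p <- index_iota 1 (N + N).+1 | prime p && C p] in
  let Q := [seq p <- index_iota 1 (N + N).+1 | prime p && ~~ C p] in
  let G (lo hi : R) := (\sum_(1 <= n < N.+1 |
      [forall i : 'I_r, real_window lo hi (hits P (n + b i))]) 1)%N in
  let E := (\sum_(i < r) \sum_(1 <= n < N.+1 |
      (Num.truncn h).+1 <= hits Q (n + b i)) 1)%N in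
  (count_normal delta b x <= G (L - w - h)%R (L + w)%R + E)%N /\
  (G (L - w)%R (L + w - h)%R <= count_normal delta b x + E)%N.
Proof.
move=> x2 h0 bN N L w P Q G E.
have omegaE n i : (1 <= n <= N)%N -> omega (n + b i) = (hits P (n + b i) + hits Q (n + b i))%N.
  by move=> /andP[n1 nN]; apply: omega_split; rewrite addn_gt0 n1 leq_add ?bN.
have small n i : ~~ ((Num.truncn h).+1 <= hits Q (n + b i))%N ->
    (0 : R) <= (hits Q (n + b i))%:R <= h.
  rewrite -ltnNge ltnS => hk; rewrite ler0n /=.
  have /andP[t1 _] := truncn_itv h0.
  by apply: le_trans t1; rewrite ler_nat.
have lt_sqr n i : (1 <= n <= N)%N -> (n + b i)%:R < x ^+ 2.
  move=> /andP[_ nN].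
  have x0 : 0 <= x by lra.
  have /andP[t1 _] := truncn_itv x0.
  have nx : n%:R <= x by apply: le_trans t1; rewrite ler_nat.
  have bx : (b i)%:R <= x by apply: le_trans t1; rewrite ler_nat.
  have xx : 2 * x < x ^+ 2 by rewrite expr2 ltr_pM2r //; lra.
  by rewrite natrD; lra.
split; apply: count_le_add => n nN.
  move=> /forallP nrm sm; apply/forallP => i.
  have := nrm i; rewrite /delta_normal -/L -/w omegaE // natrD => /andP[_].
  have /andP[s1 s2] := small n i (sm i).
  by rewrite ler_norml /real_window => /andP[u1 u2]; apply/andP; split; lra.
move=> /forallP win sm; apply/forallP => i.
have := win i; rewrite /real_window => /andP[u1 u2].
have /andP[s1 s2] := small n i (sm i).
rewrite /delta_normal lt_sqr //= -/L -/w omegaE // natrD ler_norml.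
by apply/andP; split; lra.
Qed.

End Comparison.

(** * Growth comparisons for large L *)

Section Eventually.
Variable R : realType.
Implicit Types (L a K C : R).

Lemma near_ge K : \forall L \near +oo, K <= L.
Proof. by apply: nbhs_pinfty_ge; rewrite num_real. Qed.

Lemma near_powR_ge a K : 0 < a -> \forall L \near +oo, K <= L `^ a.
Proof.
move=> a0; near=> L.
have K1 : 0 <= Num.max K 1 by rewrite le_max ler01 orbT.
have hL : Num.max K 1 `^ a^-1 <= L by near: L; exact: near_ge.
apply: (@le_trans _ _ (Num.max K 1)); first by rewrite le_max lexx.
have an : a != 0 by rewrite gt_eqF.
have e : Num.max K 1 = (Num.max K 1 `^ a^-1) `^ a by rewrite -powRrM mulVf // powRr1.
rewrite {1}e; apply: ge0_ler_powR; rewrite ?nnegrE ?powR_ge0 ?(ltW a0) //.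
Unshelve. all: by end_near. Qed.

(** In L^a = L^(a/2) L^(a/2) one factor absorbs the logarithm, through ln L <= (2/a) L^(a/2), and
    the other the constants. *)
Lemma near_ln_le_powR a K C : 0 < a -> 0 <= K -> 0 <= C ->
  \forall L \near +oo, K * ln L + C <= L `^ a.
Proof.
move=> a0 K0 C0; near=> L.
have L1 : 1 <= L by near: L; exact: near_ge.
have h1 : K * (2 / a) + C <= L `^ (a / 2).
  by near: L; apply: near_powR_ge; rewrite divr_gt0.
have h2 : 1 <= L `^ (a / 2) by near: L; apply: near_powR_ge; rewrite divr_gt0.
have -> : L `^ a = L `^ (a / 2) * L `^ (a / 2).
  by rewrite -powRD; [congr (_ `^ _); field | apply/implyP => _; lra].
have lnL : ln L <= (2 / a) * L `^ (a / 2).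
  have p0 : 0 < L `^ (a / 2) by rewrite powR_gt0; lra.
  have : ln (L `^ (a / 2)) <= L `^ (a / 2).
    rewrite -{1}[L `^ (a / 2)](subrK 1) addrC (le_trans (le_ln1Dx _)) //; lra.
  rewrite ln_powR => h.
  have := ler_wpM2l (ltW (divr_gt0 (ltr0Sn R 1) a0)) h.
  by rewrite mulrA (_ : 2 / a * (a / 2) = 1) ?mul1r //; field; lra.
have h3 : K * ln L <= K * (2 / a) * L `^ (a / 2) by rewrite -mulrA ler_wpM2l.
have h4 : (K * (2 / a) + C) * L `^ (a / 2) <= L `^ (a / 2) * L `^ (a / 2).
  by rewrite ler_wpM2r ?powR_ge0.
have h5 : C <= C * L `^ (a / 2) by rewrite ler_peMr.
by apply: le_trans h4; rewrite mulrDl; lra.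
Unshelve. all: by end_near. Qed.

Lemma exprn_le_expR L n : 0 < L -> L ^+ n <= n.+1`!%:R / L * expR L.
Proof.
move=> L0; have := expr_fact_le_expR n.+1 (ltW L0).
rewrite ler_pdivrMr ?ltr0n ?fact_gt0 // => h.
rewrite mulrAC ler_pdivlMr // -exprSr mulrC; exact: h.
Qed.

(** For n > 0, t^n / n! <= (t/n)^n e^n, and t/n <= 1/16 <= e^(-2). *)
Lemma expr_div_fact_le n (t : R) : 0 <= t -> t * 16 <= n%:R ->
  t ^+ n / n`!%:R <= expR (- n%:R).
Proof.
move=> t0 tn; case: n tn => [|n] tn; first by rewrite expr0 fact0 invr1 mulr1 oppr0 expR0.
set m : R := n.+1%:R in tn *.
have m0 : 0 < m by rewrite ltr0n.
have e16 : expR 2 <= 16 :> R.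
  have h : 2^-1 <= expR (- 2^-1) :> R by apply: le_trans (expR_ge1Dx _); lra.
  have h4 : (2^-1) ^+ 4 <= expR (- 2^-1) ^+ 4 :> R by rewrite lerXn2r ?nnegrE ?expR_ge0.
  rewrite -expRM_natl in h4; have e2 : 4%:R * - 2^-1 = - 2 :> R by field.
  rewrite e2 expRN exprVn lef_pV2 ?posrE ?expR_gt0 ?exprn_gt0 // in h4.
  by apply: le_trans h4 _; lra.
have h1 : m ^+ n.+1 / (n.+1)`!%:R <= expR m by apply: expr_fact_le_expR; rewrite ltW.
have h2 : t ^+ n.+1 <= m ^+ n.+1 * expR (- (2 * m)).
  have -> : expR (- (2 * m)) = expR (- 2) ^+ n.+1 by rewrite -expRM_natl; congr expR; ring.
  rewrite -exprMn lerXn2r ?nnegrE ?mulr_ge0 ?expR_ge0 ?(ltW m0) //.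
  rewrite expRN ler_pdivlMr ?expR_gt0 //; apply: le_trans tn; rewrite ler_wpM2l //.
have f0 : 0 <= ((n.+1)`!%:R : R)^-1 by rewrite invr_ge0.
apply: le_trans (ler_wpM2r f0 h2) _.
rewrite mulrAC (_ : - m = m - 2 * m); last by ring.
by rewrite expRD ler_wpM2r ?expR_ge0.
Qed.

End Eventually.

(** * Asymptotics *)

Section EventualBounds.
Variable R : realType.
Implicit Types (L K C eps delta : R).

Lemma near_expRN n K : \forall L \near +oo, K * expR (- L) <= L^-1 ^+ n.
Proof.
near=> L.
have L1 : 1 <= L by near: L; exact: near_ge.
have LK : K * n.+1`!%:R <= L by near: L; exact: near_ge.
have L0 : 0 < L by lra.
rewrite exprVn expRN ler_pdivrMr ?expR_gt0 // mulrC ler_pdivlMr ?exprn_gt0 //.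
have [K0|K0] := leP K 0.
  by apply: (@le_trans _ _ 0); rewrite ?expR_ge0 // mulr_le0_ge0 // exprn_ge0 // ltW.
apply: le_trans (ler_wpM2l (ltW K0) (exprn_le_expR n L0)) _.
rewrite 2!mulrA ler_piMl ?expR_ge0 // ler_pdivrMr // mul1r //.
Unshelve. all: by end_near. Qed.

Lemma powR_half_ge (delta L : R) : 0 < delta < 1 / 2 -> 1 <= L ->
  L^-1 <= L `^ (- (1 / 2) + delta).
Proof.
move=> /andP[d0 d1] L1; rewrite -powR_inv1; last by lra.
by apply: ler_powR => //; lra.
Qed.

Lemma expR_le_1D2x (t : R) : 0 <= t <= 2^-1 -> expR t <= 1 + 2 * t.
Proof.
move=> /andP[t0 t1].
have h := expR_ge1Dx (- t); rewrite expRN in h.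
have h1 : 0 < 1 - t by lra.
have h2 : expR t <= (1 - t)^-1.
  by rewrite -[expR t]invrK lef_pV2 ?posrE ?invr_gt0 ?expR_gt0.
apply: le_trans h2 _; rewrite -[leLHS]mul1r ler_pdivrMr //.
have : 0 <= t * (1 - 2 * t) by rewrite mulr_ge0; lra.
by lra.
Qed.

(** The origin of the factor sqrt(pi/2): a window of length 2w at Poisson density 1/sqrt(2 pi L) has
    mass exactly L^(delta - 1/2). *)
Lemma window_scale (delta L : R) : 0 < L ->
  Num.sqrt (2 * pi * L) * L `^ (- (1 / 2) + delta) =
  2 * (Num.sqrt (pi / 2) * L `^ delta).
Proof.
move=> L0; have pi0 := pi_gt0 R.
have -> : 2 * pi * L = 2 ^+ 2 * (pi / 2) * L by field.
have p3 : 0 <= 2 ^+ 2 :> R by rewrite exprn_ge0.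
have p2 : 0 <= 2 ^+ 2 * (pi / 2) :> R by rewrite mulr_ge0 // divr_ge0 // ltW.
rewrite (sqrtrM _ p2) (sqrtrM _ p3) sqrtr_sqr gtr0_norm //.
rewrite -(powR12_sqrt (ltW L0)) -!mulrA -powRD; last by apply/implyP => _; rewrite gt_eqF.
by congr (_ * (_ * (_ `^ _))); field.
Qed.

(** The relative errors of the window length and of the density combine through (1 + e)(1 + 2e) <= 1
    + 4e and (1 - e)^2 >= 1 - 4e. *)
Lemma poisson_window_bounds (L M h w e rho : R) (J : nat) :
  0 < e <= 4^-1 -> 0 < L -> 1 <= h -> 0 < w -> h + 2 <= e * (2 * w) ->
  10 * (w + h) ^+ 2 <= e * L -> `|M - L| <= h -> 2 * L <= J%:R ->
  Num.sqrt (2 * pi * L) * rho = 2 * w ->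
  poisson_window J (real_window (L - w - h) (L + w)) M <= (1 + 4 * e) * rho /\
  (1 - 4 * e) * rho <= poisson_window J (real_window (L - w) (L + w - h)) M.
Proof.
move=> /andP[e0 e4] L0 h1 w0 F1 F2 ML JL sc.
have k0 : 0 < Num.sqrt (2 * pi * L) by rewrite sqrtr_gt0 !mulr_gt0 // pi_gt0.
set th := 10 * (w + h) ^+ 2 / L.
have th0 : 0 <= th by rewrite divr_ge0 ?(ltW L0) // mulr_ge0 // sqr_ge0.
have the : th <= e by rewrite ler_pdivrMr.
have ex1 : expR th <= 1 + 2 * e.
  apply: le_trans (_ : expR e <= _); first by rewrite ler_expR.
  by rewrite expR_le_1D2x // ltW //=; lra.
have ex2 : 1 - e <= expR (- th) by apply: le_trans (expR_ge1Dx _); lra.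
have A1 : 1 <= w + h by lra.
have AL : w + h <= L / 2.
  have AA : w + h <= (w + h) ^+ 2 by rewrite expr2 ler_peMl //; lra.
  have eL : e * L <= 4^-1 * L by rewrite ler_wpM2r ?(ltW L0).
  by lra.
have hw : h + 2 <= w / 2.
  apply: le_trans F1 _; have : e * (2 * w) <= 4^-1 * (2 * w) by rewrite ler_wpM2r //; lra.
  by lra.
have MA : `|M - L| <= w + h by apply: le_trans ML _; lra.
have b1 : L - (w + h) <= L - w - h by lra.
have b2 : L - w - h <= L + w by lra.
have b3 : L + w <= L + (w + h) by lra.
have b4 : L + w <= J%:R by lra.
have c1 : L - (w + h) <= L - w by lra.
have c2 : L - w <= L + w - h by lra.
have c3 : L + w - h <= L + (w + h) by lra.
have c4 : L + w - h <= J%:R by lra.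
have /andP[_ u1] := poisson_real_window A1 AL MA b1 b2 b3 b4.
have /andP[u2 _] := poisson_real_window A1 AL MA c1 c2 c3 c4.
rewrite -/th in u1 u2.
have ee : 0 <= e * e by rewrite mulr_ge0 // ltW.
have ee4 : e * e <= 4^-1 * e by rewrite ler_wpM2r // ltW.
split; rewrite -(ler_pM2l k0) mulrCA sc.
  apply: le_trans u1 _.
  have -> : L + w - (L - w - h) + 2 = 2 * w + h + 2 by ring.
  have p0 : 0 <= 2 * w + h + 2 by lra.
  have p1 : 2 * w + h + 2 <= 2 * w * (1 + e) by lra.
  apply: le_trans (ler_pM p0 (expR_ge0 _) p1 ex1) _.
  rewrite -[leLHS]mulrA [leRHS]mulrC ler_wpM2l //; first by rewrite mulr_ge0 // ltW.
  by clear - e0 ee ee4; lra.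
apply: le_trans u2.
have -> : L + w - h - (L - w) - 2 = 2 * w - h - 2 by ring.
have p1 : 2 * w * (1 - e) <= 2 * w - h - 2 by lra.
have p2 : 0 <= 1 - e by lra.
have p3 : 0 <= 2 * w * (1 - e) by rewrite mulr_ge0 // mulr_ge0 // ltW.
apply: le_trans (ler_pM p3 p2 p1 ex2).
rewrite -[leRHS]mulrA [leLHS]mulrC ler_wpM2l //; first by rewrite mulr_ge0 // ltW.
by clear - e0 ee ee4; lra.
Qed.

Lemma near_poisson_window delta eps : 0 < delta < 1 / 2 -> 0 < eps <= 1 ->
  \forall L \near +oo, forall (M : R) (J : nat),
  `|M - L| <= L `^ (delta / 2) -> 2 * L <= J%:R ->
  let h := L `^ (delta / 2) in
  let w := Num.sqrt (pi / 2) * L `^ delta in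
  let rho := L `^ (- (1 / 2) + delta) in
  poisson_window J (real_window (L - w - h) (L + w)) M <= (1 + eps) * rho /\
  (1 - eps) * rho <= poisson_window J (real_window (L - w) (L + w - h)) M.
Proof.
move=> /andP[d0 d1] /andP[e0 e1].
pose e := eps / 4.
have e'0 : 0 < e by rewrite /e; lra.
have e4 : 0 < e <= 4^-1 by rewrite e'0 /e; lra.
have -> : eps = 4 * e by rewrite /e; field.
clearbody e; clear eps e0 e1.
near=> L; move=> M J ML JL.
have L1 : 1 <= L by near: L; exact: near_ge.
have L0 : 0 < L by apply: lt_le_trans L1.
have h1 : 1 <= L `^ (delta / 2) by near: L; apply: near_powR_ge; rewrite divr_gt0.
(* For h = L^(delta/2) >= 1 this gives h + 2 <= 3h <= e h^2 = e L^delta, which is at most e w. *)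
have he : 3 / e <= L `^ (delta / 2) by near: L; apply: near_powR_ge; rewrite divr_gt0.
(* Here delta < 1/2 enters, making the window short compared with sqrt(L): 10 (w + h)^2 <= 90 L^(2
   delta), because w + h <= 3 L^delta. *)
have Le : 90 / e <= L `^ (1 - 2 * delta) by near: L; apply: near_powR_ge; lra.
have s1 : 1 <= Num.sqrt (pi / 2) :> R.
  by rewrite -[leLHS]sqrtr1 ler_wsqrtr // pihalf_ge1.
have s2 : Num.sqrt (pi / 2) <= 2 :> R.
  have [/andP[_ p2] _] := pihalf_02_cos_pihalf R.
  rewrite -[leRHS](@ger0_norm R) // -sqrtr_sqr ler_wsqrtr // expr2.
  by apply: le_trans p2 _; rewrite ler_peMl // ler1n.
have dh : L `^ delta = L `^ (delta / 2) * L `^ (delta / 2).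
  rewrite -powRD; last by apply/implyP => _; rewrite gt_eqF.
  by congr (_ `^ _); field.
have Ld : L = L `^ delta * L `^ delta * L `^ (1 - 2 * delta).
  rewrite -!powRD; try by apply/implyP => _; rewrite gt_eqF.
  have ed : delta + delta + (1 - 2 * delta) = 1 by ring.
  by rewrite ed powRr1 // ltW.
have sc := window_scale delta L0.
have dp : 0 < L `^ delta by rewrite powR_gt0.
apply: poisson_window_bounds => //.
- by rewrite mulr_gt0 // (lt_le_trans ltr01).
- rewrite ler_pdivrMr // in he.
  move: (L `^ (delta / 2)) (L `^ delta) (Num.sqrt (pi / 2)) h1 he s1 dh dp.
  move=> h d s h1 he s1 dh dp {sc Ld s2 ML Le}.
  have w1 : e * d <= e * (s * d) by rewrite ler_wpM2l ?(ltW e'0) // ler_peMl // ltW.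
  have : 3 * h <= h * e * h by rewrite ler_wpM2r // (le_trans ler01).
  by rewrite dh in w1 *; lra.
rewrite ler_pdivrMr // in Le.
have h0 : 0 <= L `^ (delta / 2) by rewrite (le_trans ler01).
have le1 : L `^ (delta / 2) <= L `^ delta by rewrite dh ler_peMl.
have le2 : Num.sqrt (pi / 2) * L `^ delta <= 2 * L `^ delta by rewrite ler_wpM2r // ltW.
rewrite [X in _ <= _ * X]Ld.
move: (Num.sqrt (pi / 2) * L `^ delta) (mulr_ge0 (le_trans ler01 s1) (ltW dp)) le2 => w w0 le2.
move: (L `^ (delta / 2)) (L `^ delta) (L `^ (1 - 2 * delta)) h0 le1 le2 Le dp.
move=> h d q h0 le1 le2 Le dp {sc Ld dh ML he h1}.
have h3 : (w + h) ^+ 2 <= (3 * d) ^+ 2.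
  by rewrite lerXn2r ?nnegrE ?addr_ge0 ?mulr_ge0 ?(ltW dp) //; lra.
have : d * d * 90 <= d * d * (q * e) by rewrite ler_wpM2l // mulr_ge0 // ltW.
by rewrite exprMn [d ^+ 2]expr2 in h3; move=> ?; lra.
Unshelve. all: by end_near. Qed.

Lemma lnln_le n (u : R) : (2 <= n)%N -> n%:R <= expR u -> ln (ln n%:R) <= ln u.
Proof.
move=> n2 nu; have nR : 2 <= n%:R :> R by rewrite ler_nat.
have l0 : 0 < ln n%:R :> R by rewrite ln_gt0; lra.
have lu : ln n%:R <= u by rewrite -[leRHS]expRK ler_ln ?posrE ?expR_gt0; lra.
by rewrite ler_ln ?posrE; lra.
Qed.

Lemma lnln_ge n (u : R) : 0 < u -> expR u <= n%:R -> ln u <= ln (ln n%:R).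
Proof.
move=> u0 nu; have n0 : 0 < n%:R :> R by apply: lt_le_trans nu; rewrite expR_gt0.
have lu : u <= ln n%:R by rewrite -[leLHS]expRK ler_ln ?posrE ?expR_gt0.
by rewrite ler_ln ?posrE; lra.
Qed.

Lemma prime_recip_ge0 n : 0 <= prime_recip R n.
Proof. by apply: sumr_ge0 => p _; rewrite invr_ge0. Qed.

Lemma prime_recipS n : prime_recip R n.+1 <= prime_recip R n + 1.
Proof.
rewrite /prime_recip big_mkcond big_nat_recr //= -big_mkcond lerD2l.
case: ifP => // _; by rewrite invf_le1 ?ltr0n // ler1n.
Qed.

(** By Mertens' theorem only ln ln matters, and at z, y and 2N it is 2 ln L, L - 2 ln L and L up to
    bounded errors. *)
Lemma near_prime_sums : exists2 C : R, 0 <= C & \forall L \near +oo,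
  let z := Num.truncn (expR (L ^+ 2)) in
  let y := Num.truncn (expR (expR L / L ^+ 2)) in
  let N := Num.truncn (expR (expR L)) in
  [/\ (z <= y <= N + N)%N,
    `|prime_recip R y - prime_recip R z - L| <= 4 * ln L + C &
    prime_recip R (N + N) - (prime_recip R y - prime_recip R z) <= 4 * ln L + C].
Proof.
have [C hC] := mertens_second R.
have C0 : 0 <= C by apply: le_trans (hC 2%N isT).
exists (3 * C + 2); first by lra.
near=> L.
set z := Num.truncn (expR (L ^+ 2)); set y := Num.truncn (expR (expR L / L ^+ 2)).
set N := Num.truncn (expR (expR L)).
have L1 : 1 <= L by near: L; exact: near_ge.
have L120 : 5`!%:R <= L by near: L; exact: near_ge.
have L0 : 0 < L by lra.
have lnL : 0 <= ln L by rewrite ln_ge0.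
have L2 : 0 < L ^+ 2 by rewrite exprn_gt0.
have L21 : 1 <= L ^+ 2 by rewrite exprn_ege1.
have eL : L ^+ 4 <= expR L.
  apply: le_trans (exprn_le_expR 4 L0) _.
  by rewrite ler_piMl ?expR_ge0 // ler_pdivrMr // mul1r.
have Ly : L ^+ 2 <= expR L / L ^+ 2 by rewrite ler_pdivlMr // -exprD.
have u0 : 0 < expR L / L ^+ 2 by rewrite divr_gt0 ?expR_gt0.
have uL : expR L / L ^+ 2 <= expR L by rewrite ler_pdivrMr // ler_peMr ?expR_ge0.
have zy : (z <= y)%N by apply: le_truncn; rewrite ler_expR.
have yN : (y <= N)%N by apply: le_truncn; rewrite ler_expR.
have z2 : (2 <= z)%N.
  rewrite -[2%N](@natrK R) le_truncn //; apply: le_trans (expR_ge1Dx _); lra.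
have y2 := leq_trans z2 zy.
have N2 := leq_trans y2 yN.
have fl (t : R) : (Num.truncn (expR t))%:R <= expR t < (Num.truncn (expR t)).+1%:R.
  by rewrite truncn_itv ?expR_ge0.
have /andP[fz _] := fl (L ^+ 2); have /andP[fy1 fy2] := fl (expR L / L ^+ 2).
have /andP[fN _] := fl (expR L).
have lu : ln (expR L / L ^+ 2) = L - 2 * ln L.
  by rewrite ln_div ?posrE ?expR_gt0 // expRK lnXn // mulr_natl.
have Pz : prime_recip R z <= 2 * ln L + C.
  have := hC z z2; rewrite ler_norml => /andP[_ h].
  have := lnln_le z2 fz; rewrite lnXn // -[ln L *+ 2]mulr_natl; lra.
have Py1 : prime_recip R y <= L - 2 * ln L + C.
  have := hC y y2; rewrite ler_norml => /andP[_ h].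
  have := lnln_le y2 fy1; rewrite lu; lra.
(* Mertens' bound is taken at y + 1, which exceeds exp(e^L / L^2) since y is its floor; the extra
   term costs at most 1. *)
have Py2 : L - 2 * ln L - C - 1 <= prime_recip R y.
  have := hC y.+1 (leqW y2); rewrite ler_norml => /andP[h _].
  have := lnln_ge u0 (ltW fy2); rewrite lu; have := prime_recipS y; lra.
have PN : prime_recip R (N + N) <= L + 1 + C.
  have NN2 : (2 <= N + N)%N by rewrite (leq_trans N2) // leq_addr.
  have := hC (N + N)%N NN2; rewrite ler_norml => /andP[_ h].
  have x2 : 2 <= expR (expR L).
    by apply: le_trans (expR_ge1Dx _); have := expR_ge1Dx L; lra.
  have fNN : (N + N)%:R <= expR (2 * expR L).
    rewrite natrD (_ : 2 * expR L = expR L + expR L); last by ring.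
    rewrite expRD; apply: le_trans (_ : expR (expR L) + expR (expR L) <= _).
      by rewrite lerD.
    by rewrite -mulr2n -mulr_natl ler_wpM2r ?expR_ge0.
  have := lnln_le NN2 fNN; rewrite lnM ?posrE ?expR_gt0 // expRK.
  have : ln 2 <= 1 :> R by have := @le_ln1Dx R 1 ltac:(lra); rewrite (_ : 1 + 1 = 2).
  by lra.
have Pz0 := prime_recip_ge0 z.
split; first by rewrite zy (leq_trans yN) // leq_addr.
- by rewrite ler_norml; apply/andP; split; lra.
- by lra.
Unshelve. all: by end_near. Qed.

(** As B = O(L), S^B <= exp(e^L - L), which is at most 2N e^(-L) because exp(e^L) <= 2N. In the
    second error the exponent O(L ln L) - L^2 falls below -L. *)
Lemma near_moment_error r : \forall L \near +oo, forall B S N : nat,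
  B%:R <= 130 * r%:R * (L : R) -> S%:R <= expR (expR L / L ^+ 2) ->
  expR (expR L) / 2 <= N%:R ->
  S%:R ^+ B + N%:R * (B%:R ^+ 2 * (2 * L) ^+ B / expR (L ^+ 2))
    <= 3 * N%:R * expR (- L).
Proof.
pose c : R := 130 * r%:R.
have c0 : 0 <= c by rewrite mulr_ge0.
have ln2 : 0 <= ln 2 :> R by rewrite ln_ge0 //; lra.
near=> L; move=> B S N BL SL NL.
have L4 : 4 <= L by near: L; exact: near_ge.
have Lc : 2 * c <= L by near: L; exact: near_ge.
have Ll : c * ln L + (c * (2 + ln 2) + 1) <= L `^ 1.
  by near: L; apply: near_ln_le_powR => //; rewrite addr_ge0 // mulr_ge0 //; lra.
have L0 : 0 < L by lra.
rewrite powRr1 ?(ltW L0) // in Ll.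
have N0 : 0 <= N%:R :> R by [].
have B0 : 0 <= B%:R :> R by [].
have el : 2 * L <= expR L.
  apply: le_trans (expR_ge1Dxn 1 (ltW L0)).
  rewrite (_ : 2`!%:R = 2 :> R) //.
  have : 0 <= L * (L - 4) by rewrite mulr_ge0; lra.
  by rewrite expr2; lra.
have h1 : S%:R ^+ B <= 2 * (N%:R * expR (- L)).
  apply: (@le_trans _ _ (expR (expR L / L ^+ 2) ^+ B)).
    by rewrite lerXn2r ?nnegrE ?expR_ge0.
  rewrite -expRM_natl.
  apply: (@le_trans _ _ (expR (expR L - L))); last first.
    by rewrite expRD mulrA ler_wpM2r ?expR_ge0 //; lra.
  rewrite ler_expR.
  have : B%:R * (expR L / L ^+ 2) <= 2^-1 * expR L.
    rewrite mulrCA mulrC ler_wpM2r ?expR_ge0 // ler_pdivrMr ?exprn_gt0 //.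
    have : c * L <= 2^-1 * L * L by rewrite ler_wpM2r ?(ltW L0) //; lra.
    by rewrite /c expr2; lra.
  by lra.
have h2 : B%:R ^+ 2 * (2 * L) ^+ B / expR (L ^+ 2) <= expR (- L).
  have b1 : B%:R ^+ 2 <= expR (2%:R * B%:R) :> R.
    rewrite expRM_natl lerXn2r ?nnegrE ?expR_ge0 //.
    by apply: le_trans (expR_ge1Dx _); lra.
  have b2 : (2 * L) ^+ B = expR (B%:R * ln (2 * L)).
    by rewrite expRM_natl lnK // posrE; lra.
  rewrite b2 -expRN.
  apply: (@le_trans _ _ (expR (2%:R * B%:R) * expR (B%:R * ln (2 * L)) * expR (- L ^+ 2))).
    by rewrite !ler_wpM2r ?expR_ge0.
  rewrite -!expRD ler_expR lnM ?posrE //.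
  have lnL : 0 <= ln L by rewrite ln_ge0; lra.
  have : B%:R * (2 + ln 2 + ln L) <= c * L * (2 + ln 2 + ln L).
    by rewrite ler_wpM2r //; lra.
  have : L * (c * ln L + (c * (2 + ln 2) + 1)) <= L * L by rewrite ler_wpM2l // ltW.
  by rewrite expr2; lra.
have h3 := ler_wpM2l N0 h2.
have -> : 3 * N%:R * expR (- L) = 2 * (N%:R * expR (- L)) + N%:R * expR (- L) by ring.
exact: lerD.
Unshelve. all: by end_near. Qed.

(** With g = L^(delta/4) and h = g^2, the sum [MB] of exceptional reciprocals is at most g, so the
    ratio is at most 2/g. By the choice of s its s-th power is at most 2^s L^(-r-1), against rho^r
    >= L^(-r). *)
Lemma near_exceptional delta eps C r s : 0 < delta < 1 / 2 -> 0 < eps -> 0 <= C ->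
  r.+1%:R <= s%:R * (delta / 4) ->
  \forall L \near +oo, [/\ s%:R < L `^ (delta / 2),
   4 * ln L + C <= L `^ (delta / 2) & forall MB : R, 0 <= MB <= 4 * ln L + C ->
   r%:R * (2 * (MB / (L `^ (delta / 2) - s%:R)) ^+ s)
     <= eps * (L `^ (- (1 / 2) + delta)) ^+ r].
Proof.
move=> hd e0 C0 hs; have /andP[d0 d1] := hd; near=> L.
have L1 : 1 <= L by near: L; exact: near_ge.
have L0 : 0 < L by apply: lt_le_trans L1.
set h := L `^ (delta / 2); set g := L `^ (delta / 4).
have h2 : 2 * s%:R + 1 <= h by rewrite /h; near: L; apply: near_powR_ge; lra.
have Lg : 4 * ln L + C <= g by rewrite /g; near: L; apply: near_ln_le_powR; lra.
have g1 : 1 <= g by rewrite /g; near: L; apply: near_powR_ge; lra.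
have hg : h = g * g.
  rewrite /h /g -powRD; last by apply/implyP => _; rewrite gt_eqF.
  by congr (_ `^ _); field.
have gs : g^-1 ^+ s <= L^-1 ^+ r.+1.
  rewrite !exprVn lef_pV2 ?posrE ?exprn_gt0 ?powR_gt0 //.
  rewrite -!powR_mulrn ?powR_ge0 ?(ltW L0) // /g -powRrM.
  by apply: ler_powR => //; rewrite mulrC.
have rho : L^-1 ^+ r <= L `^ (- (1 / 2) + delta) ^+ r.
  by rewrite lerXn2r ?nnegrE ?powR_ge0 ?invr_ge0 ?(ltW L0) // powR_half_ge.
clearbody h g.
have s0 : 0 <= s%:R :> R by [].
have g0 : 0 < g by lra.
have gh : g <= h by rewrite hg ler_peMl // ltW.
split; [lra | exact: le_trans gh |] => MB /andP[MB0 MB1].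
have hs0 : 0 < h - s%:R by lra.
have q1 : MB / (h - s%:R) <= 2 * g^-1.
  rewrite ler_pdivrMr //.
  apply: (@le_trans _ _ (2 * g^-1 * (h / 2))); last first.
    by rewrite ler_wpM2l ?mulr_ge0 ?invr_ge0 ?(ltW g0) //; lra.
  rewrite hg (_ : 2 * g^-1 * (g * g / 2) = g); first exact: le_trans Lg.
  by field; rewrite gt_eqF.
apply: (@le_trans _ _ (r%:R * (2 * (2 ^+ s * L^-1 ^+ r.+1)))).
  rewrite ler_wpM2l // ler_wpM2l //.
  apply: (@le_trans _ _ ((2 * g^-1) ^+ s)).
    by rewrite lerXn2r ?nnegrE ?divr_ge0 ?mulr_ge0 ?invr_ge0 ?(ltW g0) ?(ltW hs0).
  by rewrite exprMn ler_wpM2l // exprn_ge0.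
apply: le_trans (_ : _ <= eps * L^-1 ^+ r) _; last by rewrite ler_wpM2l // ltW.
rewrite exprS [leLHS](_ : _ = r%:R * 2 * 2 ^+ s * L^-1 * L^-1 ^+ r); last by ring.
rewrite ler_wpM2r ?exprn_ge0 ?invr_ge0 ?(ltW L0) // ler_pdivrMr //.
by rewrite [eps * L]mulrC -ler_pdivrMr.
Unshelve. all: by end_near. Qed.

End EventualBounds.

(** * Counting normal tuples at x = exp(exp L) *)

Section Asymptotics.
Variable R : realType.

Lemma expr1D_le (u : R) n : 0 <= u <= 1 -> (1 + u) ^+ n <= 1 + n%:R * 2 ^+ n * u.
Proof.
move=> /andP[u0 u1].
have h : 0 <= u <= 1 + u by rewrite u0 lerDr ler01.
have := bernoulli_sub n h; rewrite addrK expr1n => hb.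
have h2 : (1 + u) ^+ n.-1 <= 2 ^+ n.
  apply: (@le_trans _ _ (2 ^+ n.-1)); first by rewrite lerXn2r ?nnegrE //; lra.
  by rewrite ler_weXn2l ?leq_pred // ler1n.
have h3 : n%:R * u * (1 + u) ^+ n.-1 <= n%:R * u * 2 ^+ n by rewrite ler_wpM2l ?mulr_ge0.
by rewrite -lerBlDl (le_trans hb) // (le_trans h3) // mulrAC.
Qed.

Lemma expr1B_ge (u : R) n : 0 <= u <= 1 -> 1 - n%:R * u <= (1 - u) ^+ n.
Proof.
move=> /andP[u0 u1].
have h : 0 <= u <= 1 by rewrite u0.
have := bernoulli_sub n h; rewrite !expr1n mulr1; lra.
Qed.

Lemma window_coef_poisson_le (L M : R) (J : nat) (W : pred nat) :
  1 <= L -> 0 <= M <= 2 * L -> 128 * L <= J%:R ->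
  `| \sum_(j < J.+1) window_coef R J W j / j`!%:R * M ^+ j - poisson_window J W M |
    <= expR (- L).
Proof.
move=> L1 /andP[M0 M2] JL.
apply: le_trans (window_coef_poisson J W M0) _.
have h : (2 * M) ^+ J.+1 / J.+1`!%:R <= expR (- J.+1%:R).
  by apply: expr_div_fact_le; rewrite ?mulr_ge0 // -natr1; lra.
apply: le_trans (ler_wpM2r (expR_ge0 M) h) _.
by rewrite -expRD ler_expR -natr1; lra.
Qed.

(** Here 4M <= 8L, and the factorial tail bound asks for J to be at least 16 times that: the origin
    of 128 L, which floor(130 L) exceeds. *)
Lemma window_deviation (L M : R) (J r : nat) : 1 <= L -> 0 <= M <= 2 * L -> 128 * L <= J%:R ->
  (1 + (4 * M) ^+ J / J`!%:R) ^+ r - 1 <= r%:R * 2 ^+ r * expR (- L).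
Proof.
move=> L1 /andP[M0 M2] JL.
have h : (4 * M) ^+ J / J`!%:R <= expR (- L).
  apply: (@le_trans _ _ (expR (- J%:R))); last by rewrite ler_expR; lra.
  by apply: expr_div_fact_le; rewrite ?mulr_ge0 //; lra.
have h0 : 0 <= (4 * M) ^+ J / J`!%:R by rewrite divr_ge0 // exprn_ge0 // mulr_ge0.
have h1 : expR (- L) <= 1 by rewrite expR_le1; lra.
have hh : 0 <= (4 * M) ^+ J / J`!%:R <= 1 by rewrite h0 (le_trans h).
rewrite lerBlDl (le_trans (expr1D_le r hh)) // lerD2l ler_wpM2l // mulr_ge0 // exprn_ge0 //.
Qed.

(** The estimate at a single L, with every requirement of largeness as a hypothesis; those that do
    not concern [b] hold beyond one threshold, which makes the result uniform in the shifts. *)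
Lemma count_normal_bounds (delta L t eps : R) (r s : nat) (b : 'I_r -> nat) :
  let x := expR (expR L) in
  let N := Num.truncn x in
  let z := Num.truncn (expR (L ^+ 2)) in
  let y := Num.truncn (expR (expR L / L ^+ 2)) in
  let M := prime_recip R y - prime_recip R z in
  let h := L `^ (delta / 2) in
  let w := Num.sqrt (pi / 2) * L `^ delta in
  let rho := L `^ (- (1 / 2) + delta) in
  let J := Num.truncn (130 * L) in
  2 <= L -> 0 < eps <= 4^-1 -> eps^-1 <= L -> 130 * r%:R <= L -> h <= L / 2 ->
  (forall i j : 'I_r, (i < j)%N -> (b i < b j)%N) ->
  (forall i, (b i)%:R <= L) ->
  (z <= y <= N + N)%N -> `|M - L| <= t -> prime_recip R (N + N) - M <= t -> t <= h ->
  s%:R < h ->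
  (forall MB : R, 0 <= MB <= t ->
     r%:R * (2 * (MB / (h - s%:R)) ^+ s) <= eps * rho ^+ r) ->
  poisson_window J (real_window (L - w - h) (L + w)) M <= (1 + eps) * rho ->
  (1 - eps) * rho <= poisson_window J (real_window (L - w) (L + w - h)) M ->
  (forall B S : nat, B%:R <= 130 * r%:R * L -> S%:R <= expR (expR L / L ^+ 2) ->
     S%:R ^+ B + N%:R * (B%:R ^+ 2 * (2 * L) ^+ B / expR (L ^+ 2))
       <= 3 * N%:R * expR (- L)) ->
  (r%:R * 2 ^+ r + 6 * (1 + expR 4) ^+ r) * expR (- L) <= eps * rho ^+ r ->
  expR (- L) <= eps * rho ->
  [/\ (1 - eps) * x <= N%:R <= x,
   (count_normal delta b x)%:R <= N%:R * (((1 + 2 * eps) * rho) ^+ r + 2 * eps * rho ^+ r) &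
   N%:R * (((1 - 2 * eps) * rho) ^+ r - 2 * eps * rho ^+ r) <= (count_normal delta b x)%:R].
Proof.
move=> x N z y M h w rho J L2 /andP[e0 e4] eL rL hL incr bL zyN Mt MBt th sh exc pw1 pw2 merr err1 err2.
have L0 : 0 < L by lra.
have h0 : 0 <= h by exact: powR_ge0.
have rho0 : 0 < rho by rewrite powR_gt0.
have xL : L + 2 <= x.
  by rewrite /x; have := expR_ge1Dx (expR L); have := expR_ge1Dx L; lra.
have x0 : 0 <= x by exact: expR_ge0.
have /andP[Nx xN] : N%:R <= x < N.+1%:R by rewrite truncn_itv.
have ex : 1 <= eps * x.
  have : eps * eps^-1 <= eps * x by rewrite ler_pM2l // (le_trans eL); lra.
  by rewrite mulfV // gt_eqF.
have Nx1 : (1 - eps) * x <= N%:R by rewrite -natr1 in xN; lra.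
have ex4 : eps * x <= 4^-1 * x by rewrite ler_wpM2r.
have Nx2 : x / 2 <= N%:R by lra.
have N1 : 1 <= N%:R :> R by rewrite -natr1 in xN; lra.
have N0 : (0 < N)%N by rewrite -(ltr0n R) (lt_le_trans ltr01).
have L2e : L <= expR (L ^+ 2).
  have : 1 * L <= L * L by rewrite ler_wpM2r; lra.
  by have := expR_ge1Dx (L ^+ 2); rewrite expr2; lra.
have bN i : (b i <= N)%N.
  by rewrite -[b i](@natrK R) le_truncn // (le_trans (bL i)) //; lra.
have bz i : (b i <= z)%N.
  by rewrite -[b i](@natrK R) le_truncn // (le_trans (bL i)).
pose Cp : pred nat := fun p => (z < p <= y)%N.
pose P := [seq p <- index_iota 1 (N + N).+1 | prime p && Cp p].
pose Q := [seq p <- index_iota 1 (N + N).+1 | prime p && ~~ Cp p].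
have [eM eMB] := recip_sum_prime R zyN.
rewrite -/P -/M in eM; rewrite -/Q -/M in eMB.
have [M1 M2] : L / 2 <= M /\ M <= 2 * L.
  by move: Mt; rewrite ler_norml => /andP[a1 a2]; clear - a1 a2 th hL; split; lra.
have M0 : 0 <= M by clear - M1 L2; lra.
have memP p : p \in P -> [/\ prime p, (z < p)%N & (p <= y)%N].
  by rewrite mem_filter => /andP[/and3P[]].
have uP : uniq P by rewrite filter_uniq // iota_uniq.
have uQ : uniq Q by rewrite filter_uniq // iota_uniq.
have prQ p : p \in Q -> prime p by rewrite mem_filter => /andP[/andP[]].
have zP p : p \in P -> expR (L ^+ 2) <= p%:R.
  move=> /memP[_ zp _]; have /andP[_ zu] : z%:R <= expR (L ^+ 2) < z.+1%:R.
    by rewrite truncn_itv ?expR_ge0.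
  by apply: le_trans (ltW zu) _; rewrite ler_nat.
have sP : (size P)%:R <= expR (expR L / L ^+ 2).
  have /andP[yu _] : y%:R <= expR (expR L / L ^+ 2) < y.+1%:R.
    by rewrite truncn_itv ?expR_ge0.
  apply: le_trans yu; rewrite ler_nat -[leqRHS](size_iota 1).
  apply: uniq_leq_size => // p /memP[/prime_gt0 p0 _ py].
  by rewrite mem_iota p0 add1n ltnS.
have P0 : (0 < size P)%N.
  rewrite lt0n size_eq0; apply/eqP => P0.
  by move: eM; rewrite P0 /recip_sum big_nil => M00; lra.
have J130 : 0 <= 130 * L by rewrite mulr_ge0 // ltW.
have /andP[J1 J2] : J%:R <= 130 * L < J.+1%:R by rewrite truncn_itv.
rewrite -natr1 in J2.
have J128 : 128 * L <= J%:R by clear - J2 L2; lra.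
have J0 : (0 < J)%N by rewrite -(ltr0n R); clear - J128 L2; lra.
pose B := (r * J)%N.
have BL : B%:R <= 130 * r%:R * L.
  by rewrite natrM mulrAC mulrC ler_wpM2r.
have Bz : B%:R / expR (L ^+ 2) <= recip_sum R P.
  apply: (@le_trans _ _ 1); last by rewrite eM; clear - M1 L2; lra.
  rewrite ler_pdivrMr ?expR_gt0 // mul1r (le_trans BL) //.
  have : 130 * r%:R * L <= L * L by rewrite ler_wpM2r // ltW.
  by have := expR_ge1Dx (L ^+ 2); rewrite expr2; lra.
(* All shifts are at most z < p, so they are their own residues modulo p, and they are distinct. *)
have sepP : separates b P.
  move=> p i j /memP[_ zp _]; rewrite !modn_small ?(leq_ltn_trans (bz _) zp) // => bij.
  by apply: val_inj; case: (ltngtP i j) => // /incr; rewrite bij ltnn.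
have prP p : p \in P -> prime p by move=> /memP[].
pose eta : R := (size P)%:R ^+ B + N%:R * (B%:R ^+ 2 * (2 * L) ^+ B / expR (L ^+ 2)).
have L21 : 1 <= 2 * L by clear - L2; lra.
have PM : recip_sum R P <= 2 * L by rewrite eM.
have moment cs : (size cs <= B)%N -> `| (\sum_(1 <= n < N.+1) joint_ffact b P cs n)%N%:R
    - N%:R * M ^+ size cs | <= eta.
  move=> csB; have := joint_moment N0 L21 PM (expR_gt0 _) csB P0 zP Bz uP prP sepP.
  by rewrite eM.
have eta1 : eta <= 3 * N%:R * expR (- L) := merr B (size P) BL sP.
have eta0 : 0 <= eta by apply: le_trans (moment [::] isT).
have L1 : 1 <= L by apply: le_trans L2; rewrite ler1n.
have M02 : 0 <= M <= 2 * L by rewrite M0.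
pose tau W : R := \sum_(j < J.+1) window_coef R J W j / j`!%:R * M ^+ j.
(* Per unit of N, the values beyond J contribute r 2^r e^(-L), and the moment error 2 (1 + e^4)^r
   times 3 e^(-L). *)
have jw W : `| (\sum_(1 <= n < N.+1 | [forall i : 'I_r, W (hits P (n + b i))]) 1)%N%:R
     - N%:R * tau W ^+ r | <= N%:R * (eps * rho ^+ r).
  apply: le_trans (joint_window (leqnn B) moment W J0 eta0 M0) _.
  have N00 : 0 <= N%:R :> R by [].
  apply: le_trans (ler_wpM2l N00 err1).
  have u1 := ler_wpM2l N00 (window_deviation r L1 M02 J128).
  have K0 : 0 <= 2 * (1 + expR 4) ^+ r :> R.
    by rewrite mulr_ge0 // exprn_ge0 // addr_ge0 // expR_ge0.
  have u2 := ler_wpM2l K0 eta1.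
  apply: le_trans (lerD u1 u2) _.
  by rewrite le_eqVlt; apply/orP; left; apply/eqP; ring.
have tw W : `|tau W - poisson_window J W M| <= eps * rho.
  by apply: le_trans err2; exact: window_coef_poisson_le.
have x2 : 2 < x by apply: lt_le_trans xL; rewrite ltrDr.
have lx : ln (ln x) = L by rewrite /x !expRK.
have [cmp1 cmp2] := count_normal_sandwich delta Cp x2 h0 bN.
rewrite !lx in cmp1 cmp2.
pose E := (\sum_(i < r) \sum_(1 <= n < N.+1 |
      ((Num.truncn h).+1 <= hits Q (n + b i))%N) 1)%N.
have EN : E%:R <= N%:R * (eps * rho ^+ r).
  have MB0 : 0 <= recip_sum R Q <= t by rewrite recip_sum_ge0 eMB.
  set X := (recip_sum R Q / (h - s%:R)) ^+ s.
  have X0 : 0 <= X by rewrite exprn_ge0 // divr_ge0 ?recip_sum_ge0 // subr_ge0 ltW.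
  apply: le_trans (_ : r%:R * (2 * N%:R * X) <= _); last first.
    rewrite (_ : r%:R * (2 * N%:R * X) = N%:R * (r%:R * (2 * X))); last by ring.
    by rewrite ler_wpM2l // exc.
  have -> : r%:R * (2 * N%:R * X) = \sum_(i < r) 2 * N%:R * X.
    by rewrite sumr_const card_ord mulr_natl.
  rewrite natr_sum; apply: ler_sum => i _.
  apply: le_trans (count_many_hits N (b i) sh (ltW (truncnS_gt h)) uQ prQ) _.
  rewrite -/X ler_wpM2r // natrD.
  have bNi : (b i)%:R <= N%:R :> R by rewrite ler_nat.
  by clear - bNi; lra.
split; first by rewrite Nx1.
  set W := real_window (L - w - h) (L + w).
  have p0 : 0 <= poisson_window J W M.
    by apply: sumr_ge0 => k _; rewrite divr_ge0 // mulr_ge0 ?exprn_ge0 ?expR_ge0.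
  have t1 : `|tau W| <= (1 + 2 * eps) * rho.
    have er : 0 <= eps * rho by rewrite mulr_ge0 // ltW.
    move: (tw W); rewrite !ler_norml => /andP[a1 a2].
    by clear - a1 a2 pw1 p0 er; apply/andP; split; lra.
  have t2 : tau W ^+ r <= ((1 + 2 * eps) * rho) ^+ r.
    apply: le_trans (ler_norm _) _; rewrite normrX lerXn2r ?nnegrE //.
    by rewrite mulr_ge0 ?(ltW rho0) //; clear - e0 e4; lra.
  have := jw W; rewrite ler_norml => /andP[_ g].
  have t3 : N%:R * tau W ^+ r <= N%:R * ((1 + 2 * eps) * rho) ^+ r by rewrite ler_wpM2l.
  move: cmp1; rewrite -(ler_nat R) natrD -/P -/Q -/E -/W.
  by clear - t3 g EN; lra.
set W := real_window (L - w) (L + w - h).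
have t1 : (1 - 2 * eps) * rho <= tau W.
  move: (tw W); rewrite !ler_norml => /andP[a1 a2].
  by clear - a1 pw2; lra.
have t0 : 0 <= (1 - 2 * eps) * rho by rewrite mulr_ge0 ?(ltW rho0) //; clear - e0 e4; lra.
have t2 : ((1 - 2 * eps) * rho) ^+ r <= tau W ^+ r.
  by rewrite lerXn2r ?nnegrE // (le_trans t0).
have := jw W; rewrite ler_norml => /andP[g _].
have t3 : N%:R * ((1 - 2 * eps) * rho) ^+ r <= N%:R * tau W ^+ r by rewrite ler_wpM2l.
move: cmp2; rewrite -(ler_nat R) natrD -/P -/Q -/E -/W.
by clear - t3 g EN; lra.
Qed.

Lemma near_normal_count (delta lambda eps : R) (r : nat) :
  0 < delta < 1 / 2 -> 0 < lambda -> 0 < eps <= 4^-1 ->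
  \forall L \near +oo, forall b : 'I_r -> nat,
    (forall i j : 'I_r, (i < j)%N -> (b i < b j)%N) ->
    (forall i : 'I_r, (b i)%:R <= lambda * L `^ (1 / 2 - delta)) ->
  let x := expR (expR L) in
  let N := Num.truncn x in
  let rho := L `^ (- (1 / 2) + delta) in
  [/\ (1 - eps) * x <= N%:R <= x,
   (count_normal delta b x)%:R <= N%:R * (((1 + 2 * eps) * rho) ^+ r + 2 * eps * rho ^+ r) &
   N%:R * (((1 - 2 * eps) * rho) ^+ r - 2 * eps * rho ^+ r) <= (count_normal delta b x)%:R].
Proof.
move=> hd l0 he; have /andP[e0 e4] := he; have /andP[d0 d1] := hd.
have [C C0 hC] := near_prime_sums R.
pose s := (Num.truncn (r.+1%:R / (delta / 4))).+1.
have hs : r.+1%:R <= s%:R * (delta / 4).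
  by rewrite -ler_pdivrMr ?divr_gt0 // ltW // truncnS_gt.
have e1 : 0 < eps <= 1 by rewrite e0 /= (le_trans e4) // invf_le1 ?ler1n.
pose D : R := r%:R * 2 ^+ r + 6 * (1 + expR 4) ^+ r.
have D0 : 0 <= D by rewrite addr_ge0 ?mulr_ge0 ?exprn_ge0 ?addr_ge0 ?expR_ge0.
have p1 : 0 < 1 - delta / 2 by lra.
have F := filterI hC (filterI (near_exceptional hd e0 C0 hs)
  (filterI (near_poisson_window hd e1) (filterI (near_moment_error R r)
  (filterI (near_expRN r (D / eps)) (filterI (near_expRN 1 eps^-1)
  (filterI (near_ge 2) (filterI (near_ge eps^-1) (filterI (near_ge (130 * r%:R))
  (filterI (near_powR_ge 2 p1) (@near_powR_ge _ (1 / 2) lambda ltac:(lra))))))))))).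
apply: filterS F => L [[zyN Mh MBh] [[sh lnh exc] [pw [merr [err1 [err2 [L2 [eL [rL [p2 Ll]]]]]]]]]].
move=> b incr bL; set rho := L `^ (- (1 / 2) + delta).
have L0 : 0 < L by apply: lt_le_trans L2.
have L1 : 1 <= L by apply: le_trans L2; rewrite ler1n.
have hL : L `^ (delta / 2) <= L / 2.
  have Ld : L = L `^ (delta / 2) * L `^ (1 - delta / 2).
    by rewrite -powRD ?subrKC ?powRr1 ?(ltW L0) //; apply/implyP => _; rewrite gt_eqF.
  by rewrite ler_pdivlMr // [X in _ <= X]Ld ler_wpM2l ?powR_ge0.
(* Eventually lambda <= L^(1/2), so b_i <= L^(1 - delta) <= L. *)
have bL' i : (b i)%:R <= L.
  apply: le_trans (bL i) _; apply: le_trans (ler_wpM2r (powR_ge0 _ _) Ll) _.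
  rewrite -powRD; last by apply/implyP => _; rewrite gt_eqF.
  by rewrite -[leRHS](powRr1 (ltW L0)); apply: ler_powR => //; lra.
have rhoL : L^-1 <= rho by exact: powR_half_ge.
have Li : 0 <= L^-1 by rewrite invr_ge0 ltW.
have e1' : D * expR (- L) <= eps * rho ^+ r.
  rewrite -ler_pdivrMl // mulrA [eps^-1 * D]mulrC (le_trans err1) //.
  by rewrite lerXn2r ?nnegrE // (le_trans Li).
have e2' : expR (- L) <= eps * rho.
  by rewrite -ler_pdivrMl // (le_trans err2) // expr1.
have J1 : 2 * L <= (Num.truncn (130 * L))%:R.
  have J130 : 0 <= 130 * L by rewrite mulr_ge0 // ltW.
  have /andP[_] := truncn_itv J130; rewrite -[X in _ < X]natr1 => J2.
  by clear - L2 J2; lra.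
have [pw1 pw2] := pw _ _ (le_trans Mh lnh) J1.
apply: (count_normal_bounds L2 he eL rL hL incr bL' zyN Mh MBh lnh sh exc pw1 pw2) => // B S BL SL.
apply: merr => //; have /andP[_] := truncn_itv (expR_ge0 (expR L)).
rewrite -[X in _ < X]natr1 => h1.
have h2 : 2 <= expR (expR L).
  by have := expR_ge1Dx (expR L); have := expR_ge1Dx L; clear - L2; lra.
by clear - h1 h2; lra.
Qed.

(** The substitution L = log log x; the form with a witness lets x be rewritten as exp(exp L). *)
Lemma near_lnln (A : R -> Prop) : (\forall L \near +oo, A L) ->
  \forall x \near +oo, exists2 L, x = expR (expR L) & A L.
Proof.
move=> [m [_ hm]]; exists (expR (expR m)); split; first exact: num_real.
move=> x mx; have x0 : 0 < x by apply: lt_trans mx; rewrite expR_gt0.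
have lx : expR m < ln x by rewrite -[ltLHS]expRK ltr_ln ?posrE ?expR_gt0.
have lx0 : 0 < ln x by apply: lt_trans lx; rewrite expR_gt0.
exists (ln (ln x)); first by rewrite !lnK.
by apply: hm; rewrite -[ltLHS]expRK ltr_ln ?posrE ?expR_gt0.
Qed.

End Asymptotics.

Theorem theorem3 (R : realType) (delta lambda : R) (r : nat)
    (hdelta : 0 < delta < 1 / 2) (hlambda : 0 < lambda) (hr : (0 < r)%N)
    (b : R -> 'I_r -> nat)
    (hb : \forall x \near +oo,
       (forall i j : 'I_r, (i < j)%N -> (b x i < b x j)%N) /\
       (forall i : 'I_r,
          (b x i)%:R <= lambda * ln (ln x) `^ (1 / 2 - delta))) :
  ((fun x : R => 1 / x * (count_normal delta (b x) x)%:R) : R -> R^o)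
    ~_ +oo
  ((fun x : R => ln (ln x) `^ ((- (1 / 2) + delta) * r%:R)) : R -> R^o).
Proof.
apply/eqaddoP => eps eps0.
(* With e = m / c, this constant covers both sides: (1 + 2e)^r + 2e <= 1 + 2 r 2^r e + 2e <= 1 + m
   above, and (1 - e)(1 - (2r + 2) e) >= 1 - (2r + 3) e >= 1 - m below. *)
pose c : R := 2 * (r%:R * 2 ^+ r) + 2 * r%:R + 4.
have r2 : 0 <= r%:R * 2 ^+ r :> R by rewrite mulr_ge0 // exprn_ge0.
have r0 : 0 <= r%:R :> R by [].
have c4 : 4 <= c by rewrite /c; lra.
have c0 : 0 < c by lra.
pose m := Num.min 1 eps.
have m0 : 0 < m by rewrite lt_min ltr01.
have m1 : m <= 1 by rewrite ge_min lexx.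
have me : m <= eps by rewrite ge_min lexx orbT.
pose e := m / c.
have e0 : 0 < e by rewrite divr_gt0.
have ec : e * c = m by rewrite mulfVK // gt_eqF.
have e4 : 0 < e <= 4^-1 by rewrite e0 ler_pdivrMr //; lra.
apply: filterS (filterI hb (near_lnln (near_normal_count r hdelta hlambda e4))).
move=> x [[incr bx] [L xL /(_ (b x))]].
have lx : ln (ln x) = L by rewrite xL !expRK.
rewrite lx in bx; rewrite -xL => /(_ incr bx) /= [/andP[N1 N2] K1 K2].
have x0 : 0 < x by rewrite xL expR_gt0.
rewrite /GRing.add /= /GRing.opp /= lx powRrM powR_mulrn ?powR_ge0 //.
set q := (L `^ (- (1 / 2) + delta)) ^+ r.
have q0 : 0 <= q by rewrite exprn_ge0 // powR_ge0.
rewrite (ger0_norm q0).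
move: N1 N2 K1 K2; rewrite !exprMn -/q.
move: (count_normal _ _ _)%:R (Num.truncn x)%:R => K N N1 N2 K1 K2.
have e2 : 0 <= 2 * e <= 1 by apply/andP; split; lra.
have u1 := expr1D_le r e2; have u2 := expr1B_ge r e2.
have N0 : 0 <= N by apply: le_trans N1; rewrite mulr_ge0 ?(ltW x0) //; lra.
have -> : 1 / x * K = K / x by rewrite mul1r mulrC.
have ce : r%:R * 2 ^+ r * (2 * e) + 2 * (r%:R * e) + 4 * e = m by rewrite -ec /c; ring.
have re0 : 0 <= r%:R * e by rewrite mulr_ge0 // ltW.
have rre0 : 0 <= r%:R * 2 ^+ r * (2 * e) by rewrite mulr_ge0 // mulr_ge0 // ltW.
clearbody e m; clear c4 c0 ec c.
have q1 : K <= x * ((1 + m) * q).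
  apply: le_trans K1 _; apply: (@le_trans _ _ (N * ((1 + m) * q))).
    rewrite ler_wpM2l // -mulrDl ler_wpM2r //.
    by lra.
  by rewrite ler_wpM2r // mulr_ge0 //; lra.
have q2 : x * ((1 - m) * q) <= K.
  apply: le_trans K2; have f0 : 0 <= 1 - (2 * r%:R + 2) * e by lra.
  apply: (@le_trans _ _ (N * ((1 - (2 * r%:R + 2) * e) * q))); last first.
    rewrite ler_wpM2l // -mulrBl ler_wpM2r //; lra.
  apply: (@le_trans _ _ ((1 - e) * x * ((1 - (2 * r%:R + 2) * e) * q))); last first.
    by rewrite ler_wpM2r // mulr_ge0.
  rewrite [(1 - e) * x]mulrC -mulrA ler_wpM2l ?(ltW x0) // mulrA ler_wpM2r //.
  have ee : 0 <= (2 * r%:R + 2) * e * e by rewrite !mulr_ge0 ?(ltW e0) //; lra.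
  by lra.
have mq : m * q <= eps * q by rewrite ler_wpM2r.
have k1 : K / x <= (1 + m) * q by rewrite ler_pdivrMr // mulrC.
have k2 : (1 - m) * q <= K / x by rewrite ler_pdivlMr // mulrC.
by rewrite ler_norml; apply/andP; split; lra.
Qed.
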